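(* Let $U$ be an optimal prefix-free machine and let $f:2^\omega\to[0,1]$, $f(x)=\sum_{\sigma\le_L x}2^{-K_U(\sigma)}$. Then the set $\{x\in 2^\omega: f(x)\text{ is not 1-random}\}$ is null (has measure zero with respect to the uniform measure on $2^\omega$).
   Context: A machine is a partial computable function $M$ from $2^{<\omega}$ to $2^{<\omega}$; it is prefix-free if its domain is a prefix-free set. $K_M(\sigma)=\min\{|\tau|: M(\tau)=\sigma\}$ ($=\infty$ if there is no such $\tau$, with $2^{-\infty}=0$). A prefix-free machine $U$ is optimal if for each prefix-free machine $M$ there is a constant $c$ with $K_U(\sigma)\le K_M(\sigma)+c$ for all $\sigma$. For $\sigma\in 2^{<\omega}$ and $x\in 2^\omega$, $\sigma<_L x$ means that there is $n$ with $\sigma\upharpoonright n=x\upharpoonright n$, $\sigma(n)=0$ and $x(n)=1$; $\sigma\le_L x$ means that $\sigma<_L x$ or $\sigma$ is an initial segment of $x$. A real $y$ is 1-random if there is a constant $c$ with $K_U(y\upharpoonright n)\ge n-c$ for all $n$. Reals in $[0,1]$ are identified with their binary expansions. *)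

(* Defs.v *)
From HB Require Import structures.
From mathcomp Require Import all_boot all_order all_algebra archimedean.
From mathcomp Require Import all_classical all_reals all_analysis.
From mathcomp Require Import measurable_realfun lra.

Set Implicit Arguments.
Unset Strict Implicit.
Unset Printing Implicit Defensive.

Import Order.TTheory GRing.Theory Num.Theory.
Import numFieldNormedType.Exports.

Local Open Scope classical_set_scope.

(* Codes for the n-ary partial recursive (mu-recursive) functions. *)
Inductive mu_rec : nat -> Type :=
| Zero : mu_rec 0
| Succ : mu_rec 1
| Proj n (i : 'I_n) : mu_rec n
| Comp k n (f : mu_rec k) (g : 'I_k -> mu_rec n) : mu_rec n
| PrimRec n (f : mu_rec n) (g : mu_rec n.+2) : mu_rec n.+1
| Mu n (f : mu_rec n.+1) : mu_rec n.

(* [mu_eval c v y]: the function coded by [c] is defined at [v], with value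
   [y]. In [PrimRec f g] the recursion variable [m] is the first argument:
   h(0, v) = f(v) and h(m+1, v) = g(m, h(m, v), v). In [Mu f] the least zero is
   searched along the first argument, all earlier values being defined. *)
Fixpoint mu_eval n (c : mu_rec n) : n.-tuple nat -> nat -> Prop :=
  match c in mu_rec n return n.-tuple nat -> nat -> Prop with
  | Zero => fun _ y => y = 0%N
  | Succ => fun v y => y = (thead v).+1
  | Proj _ i => fun v y => y = tnth v i
  | Comp k _ f g => fun v y =>
      exists w : k.-tuple nat,
        (forall i, mu_eval (g i) v (tnth w i)) /\ mu_eval f w y
  | PrimRec _ f g => fun v y =>
      (fix rec m y : Prop :=
         match m with
         | 0 => mu_eval f [tuple of behead v] y
         | m'.+1 => exists z,
             rec m' z /\ mu_eval g [tuple of m' :: z :: behead v] y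
         end) (thead v) y
  | Mu _ f => fun v y =>
      mu_eval f [tuple of y :: v] 0 /\
      forall m, (m < y)%N -> exists z, mu_eval f [tuple of m :: v] z.+1
  end.

(* Bijective base-2 numbering of the binary strings, least significant bit
   first. *)
Fixpoint string_code (s : seq bool) : nat :=
  if s is b :: s' then (b + (string_code s').*2).+1 else 0.

Lemma string_code_bij : bijective string_code.
Proof.
rewrite -setTT_bijective; split => //.
- move=> s t _ _; elim: s t => [|b s IH] [|b' t] //= [] e.
  have eb : b = b' by move: (congr1 odd e); rewrite !oddD !odd_double !addbF !oddb.
  by rewrite eb in e *; move/addnI: e => /double_inj/IH ->.
- move=> n _; have [N] := ubnP n; elim: N n => // N IH [|n] nN.
    by exists [::].
  have [|s _ es] := IH n./2; last first.
    by exists (odd n :: s); rewrite //= es odd_double_half.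
  move: nN; rewrite ltnS; apply: leq_ltn_trans.
  by rewrite leq_half_double -addnn -addnS leq_addr.
Qed.

(* Partial functions are represented by [option]-valued functions; [None] means
   undefined. *)
Definition machine (M : seq bool -> option (seq bool)) : Prop :=
  exists c : mu_rec 1, forall s t,
    M s = Some t <-> mu_eval c [tuple string_code s] (string_code t).

Definition prefix_free_machine (M : seq bool -> option (seq bool)) : Prop :=
  machine M /\ forall s t, M s <> None -> M t <> None -> prefix s t -> s = t.

Local Open Scope ring_scope.

Section complexity.
Variable R : realType.
Implicit Types (M U : seq bool -> option (seq bool)) (s : seq bool).

(* The infimum of a nonempty set of natural numbers is its minimum, and the
   infimum of the empty set is [+oo]. *)
Definition complexity M s : \bar R :=
  ereal_inf [set ((size t)%:R)%:E | t in [set t | M t = Some s]].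

Definition optimal U : Prop :=
  prefix_free_machine U /\
  forall M, prefix_free_machine M ->
    exists c : nat, forall s, (complexity U s <= complexity M s + c%:R%:E)%E.

(* 2^(-k), with 2^(-oo) = 0; the value at [k = -oo] is irrelevant. *)
Definition exp2N (k : \bar R) : R := if k is r%:E then 2 `^ (- r) else 0.

End complexity.

Definition cylinder (s : seq bool) : set (nat -> bool) :=
  [set x | mkseq x (size s) = s].

Definition cantor : Type := g_sigma_algebraType (range cylinder).

HB.instance Definition _ := Measurable.on cantor.

Definition lt_L (s : seq bool) (x : cantor) : Prop :=
  exists n, [/\ (n < size s)%N, take n s = mkseq x n,
                nth false s n = false & x n = true].

Definition le_L (s : seq bool) (x : cantor) : Prop :=
  lt_L s x \/ s = mkseq x (size s).

Section randomness.
Variable R : realType.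
Implicit Types (U : seq bool -> option (seq bool)) (x z : cantor) (y : R).

Definition one_random U z : Prop :=
  exists c : nat, forall n,
    ((n%:R - c%:R)%:E <= complexity R U (mkseq z n))%E.

Definition binary_expansion y z : Prop :=
  series (fun k => (z k)%:R / 2 ^+ k.+1 : R) @ \oo --> y.

(* A dyadic rational has two binary expansions, neither of them 1-random when
   [U] is optimal. *)
Definition real_one_random U y : Prop :=
  exists z, binary_expansion y z /\ one_random U z.

(* The sum is at most 1 for a prefix-free [U] (Kraft), so [fine] only changes its
   type. *)
Definition left_sum U x : R :=
  fine (\esum_(s in [set s | le_L s x]) (exp2N (complexity R U s))%:E).

End randomness.

Section uniform_measure.
Variable R : realType.

Definition binary_digits (r : measurableTypeR R) : cantor :=
  fun n => odd (Num.truncn (2 ^+ n.+1 * r)).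

Let measurable_odd_truncn n :
  measurable ([set r | odd (Num.truncn (2 ^+ n * r))] : set (measurableTypeR R)).
Proof.
have mge k :
    measurable ([set r | k.+1%:R <= 2 ^+ n * r] : set (measurableTypeR R)).
  rewrite (_ : [set _ | _] = `[k.+1%:R / 2 ^+ n, +oo[%classic).
    exact: measurable_itv.
  apply/seteqP; split => r /=; rewrite in_itv/= andbT;
    by rewrite ler_pdivrMr ?exprn_gt0// mulrC.
rewrite (_ : [set _ | _] = \bigcup_(k in [set k | ~~ odd k])
    ([set r : R | k.+1%:R <= 2 ^+ n * r] `\`
     [set r : R | k.+2%:R <= 2 ^+ n * r])).
  by apply: bigcup_measurable => k _; exact: measurableD.
apply/seteqP; split => r /=.
  case: (Num.truncn _) (truncn_gt_nat (2 ^+ n * r)) => // k kE ok.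
  exists k => //=; split; first by rewrite -kE.
  by rewrite -kE ltnn.
move=> [k /= ek []]; rewrite -!truncn_gt_nat => k1 /negP; rewrite -leqNgt => k2.
by rewrite (_ : Num.truncn _ = k.+1)//; apply/eqP; rewrite eqn_leq k2.
Qed.

Let measurable_binary_digits :
  measurable_fun [set: measurableTypeR R] binary_digits.
Proof.
refine (@measurability _ _ _ cantor _ _ (range cylinder) erefl _).
move=> _ [_ [s _ <-] <-].
rewrite setTI (_ : _ @^-1` _ = \bigcap_(i in `I_(size s))
    (if nth false s i then [set r | odd (Num.truncn (2 ^+ i.+1 * r))]
     else ~` [set r | odd (Num.truncn (2 ^+ i.+1 * r))])).
  apply: bigcap_measurableType => i _; case: ifP => _ //; exact: measurableC.
apply/seteqP; split => r /=.
  rewrite /cylinder/= => <- i; rewrite /= size_mkseq => si.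
  by rewrite nth_mkseq//; case: ifPn => [|/negP].
move=> H; apply: (@eq_from_nth _ false); rewrite size_mkseq// => i si.
rewrite nth_mkseq//; move: (H i si); rewrite /= /binary_digits.
by case: (nth false s i) => //= /negP/negbTE.
Qed.

HB.instance Definition _ :=
  isMeasurableFun.Build _ _ (measurableTypeR R) cantor binary_digits
    measurable_binary_digits.

(* The law of the binary digits of a uniformly distributed point of [0, 1]. *)
Definition uniform_measure : probability cantor R :=
  distribution (uniform_prob (@ltr01 R)) binary_digits.

Let bits_val (s : seq bool) : nat := foldl (fun a (b : bool) => a.*2 + b)%N 0 s.

Let bits_val_rcons s b : bits_val (rcons s b) = ((bits_val s).*2 + b)%N.
Proof. by rewrite /bits_val foldl_rcons. Qed.

Let bits_val_inj s t : size s = size t -> bits_val s = bits_val t -> s = t.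
Proof.
elim/last_ind: s t => [|s b IH] t; case/lastP: t => [|t b'] //;
  rewrite ?size_rcons// => -[st]; rewrite !bits_val_rcons => e.
have eb : b = b' by move: (congr1 odd e); rewrite !oddD !odd_double !oddb.
by rewrite eb in e *; move/addIn: e => /double_inj/(IH _ st) ->.
Qed.

Let bits_val_lt s : (bits_val s < 2 ^ size s)%N.
Proof.
elim/last_ind: s => // s b IH; rewrite bits_val_rcons size_rcons expnS mul2n.
by rewrite (@leq_trans (bits_val s).+1.*2) ?leq_double// doubleS; case: b;
  rewrite ?addn1 ?addn0.
Qed.

Let bits_val_digits (r : R) k : 0 <= r < 1 ->
  bits_val (mkseq (binary_digits r) k) = Num.truncn (2 ^+ k * r).
Proof.
move=> /andP[r0 r1]; elim: k => [|k IH].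
  by rewrite expr0 mul1r; apply/esym/truncn_def; rewrite r0.
have x0 : 0 <= 2 ^+ k * r by rewrite mulr_ge0// exprn_ge0.
rewrite mkseqS bits_val_rcons IH /binary_digits.
rewrite -[RHS]odd_double_half addnC; congr (_ + _.*2)%N.
rewrite exprS -mulrA; set x := 2 ^+ k * r in x0 *.
have x20 : 0 <= 2 * x by rewrite mulr_ge0.
apply: truncn_def; have := truncn_itv x20.
set m := Num.truncn _; rewrite -[in X in X -> _](odd_double_half m).
rewrite -addn1 -[m./2.+1]addn1 !natrD -muln2 natrM.
by case: (odd m) => /=; lra.
Qed.

Lemma uniform_measure_cylinder s :
  uniform_measure (cylinder s) = (2 ^- size s)%:E.
Proof.
have mE : measurable (binary_digits @^-1` cylinder s : set (measurableTypeR R)).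
  rewrite -[_ @^-1` _]setTI; apply: measurable_funPT => //.
  by apply: sub_sigma_algebra; exists s.
have k0 : 0 < 2 ^+ size s :> R by rewrite exprn_gt0.
have cE : binary_digits @^-1` cylinder s `&` `[0, 1[ =
  `[(bits_val s)%:R / 2 ^+ size s, (bits_val s).+1%:R / 2 ^+ size s[%classic.
  apply/seteqP; split => r /=; rewrite !in_itv/= ler_pdivrMr// ltr_pdivlMr//.
    move=> [rs r01]; rewrite mulrC -truncn_eq; last first.
      by rewrite mulr_ge0 ?exprn_ge0//; case/andP: r01.
    by rewrite -bits_val_digits// rs.
  move=> rs; have r01 : 0 <= r < 1.
    case/andP: rs => r1 r2; rewrite -(pmulr_lge0 _ k0) (le_trans _ r1)//=.
    rewrite -(ltr_pM2r k0) mul1r (lt_le_trans r2)// -natrX ler_nat.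
    exact: bits_val_lt.
  split=> //; rewrite /cylinder/=.
  apply: bits_val_inj; rewrite ?size_mkseq// bits_val_digits//.
  by apply: truncn_def; rewrite mulrC.
transitivity (\int[lebesgue_measure]_(r in binary_digits @^-1` cylinder s)
  (uniform_pdf (0 : R) 1 r)%:E)%E => //.
rewrite integral_uniform_pdf -(integral_setD1 (r := 1)); last 2 first.
- apply: measurableD => //; apply: measurableI => //; exact: measurable_itv.
- apply/measurable_EFinP/measurable_funTS.
  exact: measurable_uniform_pdf.
rewrite -setIDA setDitv1r cE (eq_integral (cst 1%E)); last first.
  move=> r; rewrite -cE inE/= in_itv/= => -[_ /andP[r0 r1]].
  by rewrite /uniform_pdf r0 (ltW r1) subr0 invr1.
rewrite integral_cst; last exact: measurable_itv.
rewrite mul1e; etransitivity; first exact: lebesgue_measure_itv.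
rewrite /= lte_fin ltr_pM2r ?invr_gt0// ltr_nat ltnSn.
by rewrite -EFinB -mulrBl -natrB// subSnn mul1r.
Qed.

End uniform_measure.

(* Main.v *)
Require Import Defs.
From mathcomp Require Import all_boot all_order all_algebra.
From mathcomp Require Import all_classical all_reals all_analysis.
From mathcomp Require Import zify ring lra.

Set Implicit Arguments.
Unset Strict Implicit.
Unset Printing Implicit Defensive.

(** Write K for the complexity with respect to U, and f_t for the computable
    stage-t approximation of f, so that f_t(x) increases to f(x). If f(x) is not
    1-random then for every c there is a U-program p of a string w of length
    n >= |p| + c such that 0.w <= f(x) <= 0.w + 2^-n. Then f_t(x) is within 2^-n
    of 0.w for all large t; say that p makes x suspicious at stage t. It suffices to show that, for all large e, the points
    that are suspicious at level c = 4e+4 and all late stages have measure at most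
    2^-e.

    Suppose that at stage t the suspicious points have measure more than 2^-e.
    Then give the string 0^(t+1) a description of some length k: a kick. This
    string is new at stage t, and it is <=_L x for every x whatsoever. As soon as
    U answers with a description of length at most k + 2e, the value f_t(x) has
    grown by 2^-(k+2e), simultaneously for all x. A program p of a string of
    length n can make x suspicious only while f_t(x) crosses an interval of length
    2 * 2^-n, so, at x, kicks of total size at most 3 * 2^(2e-n) can be blamed on
    p, which is at most 3 * 2^(-2e-4) * 2^-|p| ([blame_sum_le]). Averaging over x
    and summing over p with the Kraft inequality ([kraft]) gives
    2^-e * (total size of all kicks) <= 3 * 2^(-2e-4), whence the total size is
    less than 1 ([spent_lt1]). This has two consequences. The kicks are affordable,
    that is, all of them receive programs of a prefix-free machine
    ([kick_machine_prefix_free], [kick_machine_program]). And they must stop if their sizes are bounded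
    below, so quiet stages, with few suspicious points, occur again and again
    ([quiet_stage]). Since points that are suspicious for good are suspicious at
    all late quiet stages, they have measure at most 2^-e
    ([uniform_measure_bigcup_eventually_suspicious]).

    The constant that U loses in simulating the kick machine depends on that
    machine, which in turn needs to know when U has answered. This circle is
    broken by running one process for each e inside a single machine. Process e
    uses programs with the prefix 0^e 1 and grants U the allowance 2e. This is
    enough once e exceeds the simulation constant, because the prefix has only
    e + 1 bits.

    The kick machine has to be given by a mu-recursive code. All functions that
    describe the stages are therefore built from operations under which the total
    computable functions are closed, starting from an evaluator of the code of U
    with a bound on its searches ([fuel_evaluator]). Points of Cantor space
    enter the stages through the numbers whose binary digits are their first t
    bits; on strings of the same length, <=_L is the order of these numbers
    ([le_LE]). *)

(** * Total computable functions *)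

(** Functions of n arguments take their arguments as a list, which makes the
    closure properties below independent of n. *)
Definition computable n (f : seq nat -> nat) : Prop :=
  exists c : mu_rec n, forall (v : n.-tuple nat) y, mu_eval c v y <-> y = f v.

Lemma eq_computable n (f g : seq nat -> nat) :
  (forall v : n.-tuple nat, f v = g v) -> computable n f -> computable n g.
Proof. by move=> fg [c cP]; exists c => v y; rewrite -fg; exact: cP. Qed.

Lemma computable_comp n k (F : seq nat -> nat) (g : nat -> seq nat -> nat) :
  computable k F -> (forall i, i < k -> computable n (g i)) ->
  computable n (fun v => F (mkseq (fun i => g i v) k)).
Proof.
move=> [c cP] hg.
have [d dP] := fin_all_exists (fun i : 'I_k => hg i (ltn_ord i)).
exists (Comp c d) => v y /=.
have gE (w : k.-tuple nat) :
    (forall i, mu_eval (d i) v (tnth w i)) <-> w = mkseq (fun i => g i v) k :> seq nat.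
  split=> [hw|wE i].
    apply: (@eq_from_nth _ 0); rewrite ?size_mkseq ?size_tuple// => i ik.
    by rewrite nth_mkseq// -[i]/(val (Ordinal ik)) -tnth_nth; exact/dP.
  by apply/dP; rewrite (tnth_nth 0) wE nth_mkseq.
split=> [[w [/gE <- /cP //]]|->].
exists [tuple of mkseq (fun i => g i v) k]; split; [exact/gE|exact/cP].
Qed.

Lemma computable_nth n i : computable n (fun v => nth 0 v i).
Proof.
have [ni|ni] := ltnP i n.
  by exists (Proj (Ordinal ni)) => v y /=; rewrite (tnth_nth 0).
apply: (@eq_computable _ (fun v => (fun=> 0) (mkseq (fun=> 0) 0))).
  by move=> v; rewrite nth_default ?size_tuple.
apply: (@computable_comp _ 0 (fun=> 0) (fun _ _ => 0)) => //.
by exists Zero.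
Qed.

(** The next lemmas turn a function proved computable on its variables into a
    closure property. *)
Lemma computable_app1 n (F : nat -> nat) f :
  computable 1 (fun v => F (head 0 v)) -> computable n f ->
  computable n (fun v => F (f v)).
Proof. by move=> hF hf; apply: (computable_comp (g := fun _ => f) hF). Qed.

Lemma computable_app2 n (F : nat -> nat -> nat) f g :
  computable 2 (fun v => F (head 0 v) (head 0 (behead v))) ->
  computable n f -> computable n g -> computable n (fun v => F (f v) (g v)).
Proof.
move=> hF hf hg.
by apply: (computable_comp (g := fun i => nth f [:: f; g] i) hF) => -[|[|]].
Qed.

Lemma computable_app3 n (F : nat -> nat -> nat -> nat) f g h :
  computable 3 (fun v => F (head 0 v) (head 0 (behead v))
                           (head 0 (behead (behead v)))) ->
  computable n f -> computable n g -> computable n h ->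
  computable n (fun v => F (f v) (g v) (h v)).
Proof.
move=> hF hf hg hh.
by apply: (computable_comp (g := fun i => nth f [:: f; g; h] i) hF) => -[|[|[|]]].
Qed.

Lemma computable_app4 n (F : nat -> nat -> nat -> nat -> nat) f g h k :
  computable 4 (fun v => F (head 0 v) (head 0 (behead v))
    (head 0 (behead (behead v))) (head 0 (behead (behead (behead v))))) ->
  computable n f -> computable n g -> computable n h -> computable n k ->
  computable n (fun v => F (f v) (g v) (h v) (k v)).
Proof.
move=> hF hf hg hh hk.
by apply: (computable_comp (g := fun i => nth f [:: f; g; h; k] i) hF)
  => -[|[|[|[|]]]].
Qed.

(** The variables bound by sums, recursions and searches are pushed in front of
    the argument list. The arguments are thus always of the form [head 0 (E v)]
    for an iterated tail [E], which is what makes the proofs syntax-directed. *)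
Definition tail_of n (E : seq nat -> seq nat) : Prop :=
  exists k, forall v : n.-tuple nat, E v = drop k v.

Lemma tail_of_id n : tail_of n id.
Proof. by exists 0 => v; rewrite drop0. Qed.

Lemma tail_of_behead n E : tail_of n E -> tail_of n (fun v => behead (E v)).
Proof. by move=> [k h]; exists k.+1 => v; rewrite h -drop1 drop_drop add1n. Qed.

Lemma computable_head n E : tail_of n E -> computable n (fun v => head 0 (E v)).
Proof.
move=> [k h]; apply: eq_computable (computable_nth n k) => v.
by rewrite h -nth0 nth_drop addn0.
Qed.

Lemma computable0 n : computable n (fun=> 0).
Proof.
apply: eq_computable (computable_nth n n) => v.
by rewrite nth_default ?size_tuple.
Qed.

Lemma computableS n f : computable n f -> computable n (fun v => (f v).+1).
Proof.
apply: (@computable_app1 _ S); exists Succ => v y /=.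
by rewrite (tuple_eta v).
Qed.

Lemma computable_const n a : computable n (fun=> a).
Proof. by elim: a => [|a]; [exact: computable0|exact: computableS]. Qed.

Lemma mkseq_cons T (f : nat -> T) n :
  mkseq f n.+1 = f 0 :: mkseq (fun i => f i.+1) n.
Proof. by rewrite /mkseq/= (iotaDl 1 0) -map_comp. Qed.

(** Primitive recursion with a computable bound, in the form of an iteration that
    knows its index. *)
Lemma computable_iteri n b (G : nat -> nat -> seq nat -> nat) f :
  computable n b -> computable n f ->
  computable n.+2
    (fun u => G (head 0 u) (head 0 (behead u)) (behead (behead u))) ->
  computable n (fun v => iteri (b v) (fun m z => G m z v) (f v)).
Proof.
move=> hb [cf cfP] [cG cGP].
have hrec : computable n.+1 (fun u =>
    iteri (head 0 u) (fun m z => G m z (behead u)) (f (behead u))).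
  exists (PrimRec cf cG) => u y /=.
  have -> : head 0 u = thead u by case/tupleP: u.
  elim: (thead u) y => [|m IH] y /=; first exact: cfP.
  split=> [[z [/IH -> /cGP //]]|->].
  by eexists; split; [apply/IH; reflexivity|apply/cGP].
have := computable_comp
  (g := fun i => if i is i'.+1 then fun v => nth 0 v i' else b) hrec.
move=> /(_ n) h; apply: eq_computable (h _) => [v|[|i] _]; last 2 first.
- by [].
- exact: computable_nth.
rewrite mkseq_cons.
by rewrite (_ : mkseq _ n = v)// -[RHS](mkseq_nth 0) size_tuple.
Qed.

Lemma computableD n f g : computable n f -> computable n g ->
  computable n (fun v => f v + g v).
Proof.
move=> hf hg; apply: (@eq_computable _
  (fun v => iteri (g v) (fun=> S) (f v))).
  by move=> v; elim: (g v) => [|m /= ->]; rewrite ?addn0 ?addnS.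
apply: computable_iteri => //.
by apply: computableS; apply: computable_head; exact/tail_of_behead/tail_of_id.
Qed.

Lemma computableM n f g : computable n f -> computable n g ->
  computable n (fun v => f v * g v).
Proof.
move=> hf hg; apply: (@computable_app2 _ muln f g) => //.
apply: (@eq_computable _ (fun v => iteri (head 0 (behead v))
  (fun _ z => z + head 0 v) 0)).
  move=> v; elim: (head 0 (behead v)) => [|m /= ->]; rewrite ?muln0//.
  by rewrite mulnS addnC.
apply: computable_iteri; [|exact: computable0|apply: computableD];
  apply: computable_head; by do ?[exact: tail_of_id|apply: tail_of_behead].
Qed.

Lemma computable_pred n f : computable n f -> computable n (fun v => (f v).-1).
Proof.
move=> hf; apply: (@eq_computable _ (fun v => iteri (f v) (fun m _ => m) 0)).
  by move=> v; case: (f v).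
apply: computable_iteri => //; first exact: computable0.
by apply: computable_head; exact: tail_of_id.
Qed.

Lemma computableB n f g : computable n f -> computable n g ->
  computable n (fun v => f v - g v).
Proof.
move=> hf hg; apply: (@eq_computable _
  (fun v => iteri (g v) (fun _ z => z.-1) (f v))).
  by move=> v; elim: (g v) => [|m /= ->]; rewrite ?subn0 ?subnS.
apply: computable_iteri => //; apply: computable_pred.
by apply: computable_head; apply/tail_of_behead/tail_of_id.
Qed.

Lemma computable_expn n f g : computable n f -> computable n g ->
  computable n (fun v => f v ^ g v).
Proof.
move=> hf hg; apply: (@computable_app2 _ expn f g) => //.
apply: (@eq_computable _ (fun v => iteri (head 0 (behead v))
  (fun _ z => z * head 0 v) 1)).
  move=> v; elim: (head 0 (behead v)) => [|m /= ->]; rewrite ?expn0//.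
  by rewrite expnS mulnC.
apply: computable_iteri; [|exact: computable_const|apply: computableM];
  apply: computable_head; by do ?[exact: tail_of_id|apply: tail_of_behead].
Qed.

Lemma computable_negb n (P : seq nat -> bool) :
  computable n (fun v => P v) -> computable n (fun v => ~~ P v).
Proof.
move=> h; apply: (@eq_computable _ (fun v => 1 - P v)).
  by move=> v; case: (P v).
by apply: computableB => //; exact: computable_const.
Qed.

Lemma computable_and n (P Q : seq nat -> bool) :
  computable n (fun v => P v) -> computable n (fun v => Q v) ->
  computable n (fun v => P v && Q v).
Proof.
move=> hP hQ; apply: (@eq_computable _ (fun v => P v * Q v)).
  by move=> v; rewrite mulnb.
exact: computableM.
Qed.

Lemma computable_or n (P Q : seq nat -> bool) :
  computable n (fun v => P v) -> computable n (fun v => Q v) ->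
  computable n (fun v => P v || Q v).
Proof.
move=> hP hQ; apply: (@eq_computable _ (fun v => ~~ (~~ P v && ~~ Q v))).
  by move=> v; rewrite negb_and !negbK.
by apply/computable_negb/computable_and; exact: computable_negb.
Qed.

Lemma computable_leq n f g : computable n f -> computable n g ->
  computable n (fun v => f v <= g v).
Proof.
move=> hf hg; apply: (@eq_computable _ (fun v => 1 - (f v - g v))).
  by move=> v; rewrite /leq; case: (f v - g v).
by apply: computableB; [exact: computable_const|exact: computableB].
Qed.

Lemma computable_eq n f g : computable n f -> computable n g ->
  computable n (fun v => f v == g v).
Proof.
move=> hf hg; apply: (@eq_computable _ (fun v => (f v <= g v) && (g v <= f v))).
  by move=> v; rewrite eqn_leq.
by apply: computable_and; exact: computable_leq.
Qed.

Lemma computable_if n (P : seq nat -> bool) f g :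
  computable n (fun v => P v) -> computable n f -> computable n g ->
  computable n (fun v => if P v then f v else g v).
Proof.
move=> hP hf hg; apply: (@eq_computable _ (fun v => P v * f v + ~~ P v * g v)).
  by move=> v; case: (P v); rewrite !mul1n ?mul0n ?addn0.
apply: computableD; apply: computableM => //; exact: computable_negb.
Qed.

(** The range is an interval of nat, and not of an ordinal type, so that the
    summand is recovered from the goal by higher-order pattern unification. *)
Section bigop.
Variables (n : nat) (b : seq nat -> nat) (F : nat -> seq nat -> nat).
Hypothesis b_computable : computable n b.
Hypothesis F_computable : computable n.+1 (fun u => F (head 0 u) (behead u)).

Let F2 : computable n.+2 (fun u => F (head 0 u) (behead (behead u))).
Proof.
apply: eq_computable (computable_comp
  (g := fun i v => nth 0 v (if i is 0 then 0 else i.+1)) F_computable _).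
  case/tupleP=> a u; case/tupleP: u => c u.
  by rewrite mkseq_cons /= -[in RHS](mkseq_nth 0 u) size_tuple.
by move=> i _; exact: computable_nth.
Qed.

Lemma computable_sum : computable n (fun v => \sum_(0 <= i < b v) F i v).
Proof.
apply: (@eq_computable _ (fun v => iteri (b v) (fun i z => z + F i v) 0)).
  by move=> v; elim: (b v) => [|m IH]; [rewrite big_geq|rewrite big_nat_recr//= -IH].
apply: computable_iteri => //; first exact: computable0.
apply: computableD => //.
by apply: computable_head; apply/tail_of_behead/tail_of_id.
Qed.

Lemma computable_max : computable n (fun v => \max_(0 <= i < b v) F i v).
Proof.
apply: (@eq_computable _ (fun v => iteri (b v)
  (fun i z => if z <= F i v then F i v else z) 0)).
  move=> v; elim: (b v) => [|m IH]; [by rewrite big_geq|].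
  by rewrite big_nat_recr//= -IH; case: leqP; lia.
have hd : computable n.+2 (fun u => head 0 (behead u)).
  by apply: computable_head; apply/tail_of_behead/tail_of_id.
apply: computable_iteri => //; first exact: computable0.
by apply: computable_if => //; exact: computable_leq.
Qed.

End bigop.

Lemma computable_has n b (P : nat -> seq nat -> bool) : computable n b ->
  computable n.+1 (fun u => P (head 0 u) (behead u)) ->
  computable n (fun v => has (fun i => P i v) (iota 0 (b v))).
Proof.
move=> hb hP; apply: (@eq_computable _
  (fun v => ~~ (\sum_(0 <= i < b v) P i v <= 0))).
  move=> v; congr nat_of_bool; rewrite leqn0 sum_nat_seq_eq0 -has_predC.
  by rewrite /index_iota subn0; apply: eq_has => i; rewrite /= eqb0 negbK.
apply: computable_negb; apply: computable_leq; last exact: computable0.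
exact: (computable_sum (F := fun i v => P i v)).
Qed.

Lemma sum_ltn q n : q <= n -> \sum_(0 <= i < n) (i < q) = q.
Proof.
move=> qn; rewrite (big_cat_nat (n := q))//=.
rewrite (eq_big_nat _ _ (F2 := fun=> 1)); last by move=> i /andP[_ ->].
have -> : \sum_(q <= i < n) (i < q) = 0.
  by rewrite big_nat_cond big1// => i /andP[/andP[qi _] _]; rewrite ltnNge qi.
by rewrite addn0 sum_nat_const_nat subn0 muln1.
Qed.

Lemma computable_divn n f g : computable n f -> computable n g ->
  computable n (fun v => f v %/ g v).
Proof.
move=> hf hg; apply: (@computable_app2 _ divn f g) => //.
pose a := fun v : seq nat => head 0 v; pose d := fun v => head 0 (behead v).
apply: (@eq_computable _ (fun v =>
    \sum_(0 <= i < a v) ((0 < d v) && (i.+1 * d v <= a v)))).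
  move=> v; rewrite -/(a v) -/(d v).
  have [->|d0] := posnP (d v); first by rewrite big1.
  rewrite (eq_bigr (fun i => nat_of_bool (i < a v %/ d v))).
    by rewrite sum_ltn// leq_div.
  by move=> i _; rewrite leq_divRL.
rewrite /a /d; apply: computable_sum; last apply: computable_and;
  do ?[apply: computable_leq|apply: computableM|apply: computableS
      |exact: computable0];
  apply: computable_head; by do ?[exact: tail_of_id|apply: tail_of_behead].
Qed.

(** [computability] follows the syntax of the function; the hook is redefined
    whenever further functions have been shown to be computable. *)
Ltac computability_hook := fail.

Ltac computability_step :=
  match goal with
  | |- tail_of _ _ => first [exact: tail_of_id | apply: tail_of_behead]
  | |- computable _ (fun v => head 0 _) => apply: computable_head
  | |- computable _ (head 0) => apply: computable_head
  | |- computable _ (fun v => S _) => apply: computableS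
  | |- computable _ (fun v => addn _ _) => apply: computableD
  | |- computable _ (fun v => subn _ _) => apply: computableB
  | |- computable _ (fun v => predn _) => apply: computable_pred
  | |- computable _ (fun v => muln _ _) => apply: computableM
  | |- computable _ (fun v => expn _ _) => apply: computable_expn
  | |- computable _ (fun v => divn _ _) => apply: computable_divn
  | |- computable _ (fun v => \sum_(0 <= i < _) _) => apply: computable_sum
  | |- computable _ (fun v => \max_(0 <= i < _) _) => apply: computable_max
  | |- computable _ (fun v => nat_of_bool (andb _ _)) => apply: computable_and
  | |- computable _ (fun v => nat_of_bool (orb _ _)) => apply: computable_or
  | |- computable _ (fun v => nat_of_bool (negb _)) => apply: computable_negb
  | |- computable _ (fun v => nat_of_bool (leq _ _)) => apply: computable_leq
  | |- computable _ (fun v => nat_of_bool (eq_op _ _)) => apply: computable_eq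
  | |- computable _ (fun v => nat_of_bool (has _ _)) => apply: computable_has
  | |- computable _ (fun v => if _ then _ else _) => apply: computable_if
  | |- computable _ (fun v => iteri _ _ _) => apply: computable_iteri
  | |- computable _ (fun=> _) => exact: computable_const
  end.

Ltac computability :=
  repeat first [assumption | computability_hook | computability_step].

Lemma computable_odd n f : computable n f -> computable n (fun v => odd (f v)).
Proof.
move=> hf; apply: (@eq_computable _ (fun v => f v - f v %/ 2 * 2)).
  by move=> v; lia.
by computability.
Qed.

(** * Bounded evaluation of mu-recursive codes *)

Lemma computable_call n k (E : nat -> seq nat -> nat) t
    (gs : seq (seq nat -> nat)) :
  computable k.+1 (fun u => E (head 0 u) (behead u)) -> computable n t ->
  size gs = k -> (forall i, i < k -> computable n (nth (fun=> 0) gs i)) ->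
  computable n (fun v => E (t v) [seq g v | g <- gs]).
Proof.
move=> hE ht gk hgs; apply: eq_computable (computable_comp
  (g := fun i => nth (fun=> 0) (t :: gs) i) hE _) => [v|[|i]//=]; last exact: hgs.
rewrite mkseq_cons/=; congr (E (t v)).
apply: (@eq_from_nth _ 0); rewrite size_mkseq ?size_map// => i ik.
by rewrite nth_mkseq// (nth_map (fun=> 0)) ?gk.
Qed.

Lemma computable_call_drop d j k (E : nat -> seq nat -> nat) t
    (gs : seq (seq nat -> nat)) :
  computable k.+1 (fun u => E (head 0 u) (behead u)) ->
  computable (d + j) t -> size gs + j = k ->
  (forall i, i < size gs -> computable (d + j) (nth (fun=> 0) gs i)) ->
  computable (d + j) (fun v => E (t v) ([seq g v | g <- gs] ++ drop d v)).
Proof.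
move=> hE ht gk hgs; apply: eq_computable (computable_call
  (gs := gs ++ mkseq (fun i v => nth 0 v (d + i)) j) hE ht _ _) => [v||i ik].
- rewrite map_cat; congr (E _ (_ ++ _)); apply: (@eq_from_nth _ 0).
    by rewrite size_map size_mkseq size_drop size_tuple addKn.
  move=> i; rewrite size_map size_mkseq => ij.
  by rewrite (nth_map (fun=> 0)) ?size_mkseq// nth_mkseq// nth_drop.
- by rewrite size_cat size_mkseq.
rewrite nth_cat; case: ltnP => [|gi]; first exact: hgs.
by rewrite nth_mkseq -?gk; [exact: computable_nth|rewrite ltn_subLR// gk].
Qed.

Lemma computable_all n k (P : nat -> seq nat -> bool) :
  (forall i, i < k -> computable n (fun v => P i v)) ->
  computable n (fun v => all (fun i => P i v) (iota 0 k)).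
Proof.
elim: k => [_|k IH hP]; first exact: computable_const.
apply: (@eq_computable _ (fun v => all (fun i => P i v) (iota 0 k) && P k v)).
  by move=> v; rewrite -[in RHS](addn1 k) iotaD all_cat/= andbT.
by apply: computable_and; [apply: IH => i /ltnW; exact: hP|exact: hP].
Qed.

Lemma all_iotaP k (P : pred nat) :
  reflect (forall i, i < k -> P i) (all P (iota 0 k)).
Proof.
apply: (iffP allP) => h i; first by move=> ik; apply: h; rewrite mem_iota.
by rewrite mem_iota => /h.
Qed.

(** The value 0 of F stands for a computation that has not ended, and y.+1 for the
    result y. The search is thus for a result 0, and it fails when an earlier
    computation has not ended. *)
Definition bounded_search (F : nat -> nat) t : nat :=
  \sum_(0 <= y < t) ((F y == 1) && ~~ has (fun m => F m <= 1) (iota 0 y)) * y.+1.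

Lemma bounded_searchP F t y : bounded_search F t = y.+1 <->
  [/\ y < t, F y = 1 & forall m, m < y -> 1 < F m].
Proof.
pose least z := (F z == 1) && ~~ has (fun m => F m <= 1) (iota 0 z).
have leastP z : least z <-> F z = 1 /\ forall m, m < z -> 1 < F m.
  rewrite /least -all_predC; split.
    by case/andP=> /eqP Fz /all_iotaP h; split=> // m /h /=; rewrite -ltnNge.
  case=> -> h; rewrite eqxx; apply/all_iotaP => m /h /=; by rewrite -ltnNge.
have suf z : z < t -> least z -> bounded_search F t = z.+1.
  move=> zt lz; rewrite /bounded_search.
  transitivity (\sum_(0 <= y < t | y == z) z.+1); last first.
    by rewrite big_nat1_eq zt.
  rewrite [RHS]big_mkcond; apply: eq_bigr => m _; rewrite -/(least m).
  case: eqP => [->|mz]; first by rewrite lz mul1n.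
  case: (boolP (least m)) => // /leastP[Fm hm]; move/leastP: lz => [Fz hz].
  have [|] := ltnP z m; first by move=> /hm; rewrite Fz.
  by rewrite leq_eqVlt => /predU1P[/mz//|/hz]; rewrite Fm.
split=> [e|[yt Fy hy]]; last by apply: suf => //; exact/leastP.
have /hasP[z] : has least (iota 0 t).
  rewrite -[has _ _]negbK; apply/negP => /hasPn h; move: e.
  rewrite /bounded_search big_seq big1// => z; rewrite /index_iota subn0.
  by move=> /h; rewrite -/(least z) => /negbTE ->.
rewrite mem_iota/= => zt lz; move: e; rewrite (suf z)// => -[<-].
by move/leastP: lz => [].
Qed.

(** Any mu-recursive code can be run with a bound t on its searches. The result is
    0 if the bound was too small and y.+1 if the value is y; it is a total
    computable function, also of t. *)
Theorem fuel_evaluator n (c : mu_rec n) : exists E : nat -> seq nat -> nat,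
  [/\ computable n.+1 (fun u => E (head 0 u) (behead u)),
    forall t t' v y, t <= t' -> E t v = y.+1 -> E t' v = y.+1 &
    forall (v : n.-tuple nat) y, mu_eval c v y <-> exists t, E t v = y.+1].
Proof.
elim: n / c => [||n i|k n f [Ef [cf mf sf]] g IHg
  |n f [Ef [cf mf sf]] g [Eg [cg mg sg]]|n f [Ef [cf mf sf]]].
- exists (fun _ _ => 1); split=> // [|v y /=]; first by computability.
  by split=> [->|[_ [->]]]; first by exists 0.
- exists (fun _ v => (head 0 v).+2); split=> // [|v y]; first by computability.
  case/tupleP: v => a v; rewrite /= theadE.
  by split=> [->|[_ [->]]]; first by exists 0.
- exists (fun _ v => (nth 0 v i).+1); split=> // [|v y].
    apply: computableS; apply: eq_computable (computable_nth _ i.+1) => v.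
    by case/tupleP: v.
  rewrite /= (tnth_nth 0).
  by split=> [->|[_ [->]]]; first by exists 0.
- have [Eg EgP] := fin_all_exists IHg.
  pose G i := if insub i is Some j then Eg j else fun _ _ => 0.
  have GE (i : 'I_k) : G i = Eg i by rewrite /G valK.
  have cG i : i < k -> computable n.+1 (fun u => G i (head 0 u) (behead u)).
    by move=> ik; have [] := EgP (Ordinal ik); rewrite -GE.
  have mG i : i < k -> forall t t' v y, t <= t' ->
      G i t v = y.+1 -> G i t' v = y.+1.
    by move=> ik; have [] := EgP (Ordinal ik); rewrite -GE.
  have sG (i : 'I_k) : forall (v : n.-tuple nat) y,
      mu_eval (g i) v y <-> exists t, G i t v = y.+1.
    by have [] := EgP i; rewrite -GE.
  clearbody G; move: GE => _; clear Eg EgP IHg.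
  (* The successor in the result of an evaluator is removed before the result is
     passed on. *)
  pose arg i t v := (G i t v).-1.
  exists (fun t v => if all (fun i => 0 < G i t v) (iota 0 k)
    then Ef t [seq a v | a <- mkseq (fun i => arg i t) k] else 0); split.
  + apply: computable_if; last exact: computable_const.
      apply: (computable_all (P := fun i u => 0 < G i (head 0 u) (behead u))).
      by move=> i /cG ?; computability.
    apply: (@eq_computable _ (fun u => Ef (head 0 u) [seq a u |
      a <- mkseq (fun i u => arg i (head 0 u) (behead u)) k])).
      by move=> u; rewrite -!map_comp.
    apply: (computable_call cf); rewrite ?size_mkseq//; first by computability.
    by move=> i ik; rewrite nth_mkseq//; apply: computable_pred; exact: cG.
  + move=> t t' v y tt'; case: ifP => // /all_iotaP hG.
    rewrite ifT; last first.
      apply/all_iotaP => i ik; move: (hG i ik); case e: (G i t v) => [//|z] _.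
      by rewrite (mG i ik _ _ _ _ tt' e).
    move=> /(mf _ _ _ _ tt') <-; congr Ef.
    rewrite -!map_comp; apply/eq_in_map => i; rewrite mem_iota/= => ik.
    move: (hG i ik); rewrite /arg; case e: (G i t v) => [//|z] _.
    by rewrite (mG i ik _ _ _ _ tt' e).
  + move=> v y /=; split.
      move=> [w [hw /sf[t0 h0]]].
      have [T hT] := fin_all_exists (fun i => (sG i v (tnth w i)).1 (hw i)).
      pose t := maxn t0 (\max_i T i).
      have tT i : T i <= t by rewrite leq_max leq_bigmax orbT.
      exists t; rewrite ifT; last first.
        apply/all_iotaP => i ik.
        by rewrite (mG i ik _ _ _ _ (tT (Ordinal ik)) (hT (Ordinal ik))).
      rewrite (_ : map _ _ = w); first by apply: mf h0; rewrite leq_maxl.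
      apply: (@eq_from_nth _ 0); rewrite size_map size_mkseq ?size_tuple// => i ik.
      rewrite (nth_map (fun=> 0)) ?size_mkseq// nth_mkseq// /arg.
      rewrite (mG i ik _ _ _ _ (tT (Ordinal ik)) (hT (Ordinal ik))).
      by rewrite (tnth_nth 0).
    move=> [t]; case: ifP => // /all_iotaP hG hf.
    exists [tuple of mkseq (fun i => arg i t v) k]; split.
      move=> i; apply/sG; exists t; rewrite (tnth_nth 0) nth_mkseq//.
      by rewrite prednK// hG.
    by apply/sf; exists t; rewrite -hf /mkseq -map_comp.
- pose R t w m := iteri m (fun m z => if 0 < z then Eg t (m :: z.-1 :: w) else 0)
    (Ef t w).
  have mR t t' w m z : t <= t' -> R t w m = z.+1 -> R t' w m = z.+1.
    move=> tt'; elim: m z => [|m IH] z /=; first exact: mf.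
    rewrite -/(R _ _ _) -/(R _ _ _).
    by case e: (R t _ m) => [//|y]; rewrite (IH y)//=; exact: mg.
  exists (fun t v => R t (behead v) (head 0 v)); split.
  + rewrite /R; computability.
      apply: eq_computable (computable_call_drop (d := 2) (j := n) (gs := [::]) cf
        (t := head 0) _ _ _) => //= [v|].
        by case/tupleP: v => a v; case/tupleP: v => b v /=; rewrite !drop0.
      by computability.
    apply: eq_computable (computable_call_drop (d := 4) (j := n)
      (gs := [:: head 0; fun u => (head 0 (behead u)).-1]) cg
      (t := fun u => head 0 (behead (behead u))) _ _ _) => //= [v||[|[|]]//= _].
    * case/tupleP: v => a v; case/tupleP: v => b v.
      by case/tupleP: v => c v; case/tupleP: v => d v /=; rewrite !drop0.
    all: computability.
  + by move=> t t' v y; exact: mR.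
  + move=> v y /=; have -> : head 0 v = thead v by case/tupleP: v.
    elim: (thead v) y => [|m IH] y /=; first exact: sf.
    split=> [[z [/IH[t ht] /sg[t' ht']]]|[t]].
      exists (maxn t t'); rewrite -/(R _ _ _) (mR _ _ _ _ _ _ ht) ?leq_maxl//=.
      by apply: mg ht'; rewrite leq_maxr.
    rewrite -/(R _ _ _); case e: (R t _ m) => [//|z] h.
    by exists z; split; [apply/IH; exists t|apply/sg; exists t].
- exists (fun t v => bounded_search (fun y => Ef t (y :: v)) t); split.
  + have hf : computable n.+2 (fun u => Ef (head 0 (behead u))
        (head 0 u :: behead (behead u))).
      apply: eq_computable (computable_call_drop (d := 2) (j := n)
        (gs := [:: head 0]) cf (t := fun u => head 0 (behead u)) _ _ _)
        => //= [v||[|]//= _].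
      * by case/tupleP: v => a v; case/tupleP: v => b v /=; rewrite !drop0.
      all: computability.
    rewrite /bounded_search; computability.
    apply: eq_computable (computable_call_drop (d := 3) (j := n)
        (gs := [:: head 0]) cf (t := fun u => head 0 (behead (behead u))) _ _ _)
        => //= [v||[|]//= _].
    * case/tupleP: v => a v; case/tupleP: v => b v; case/tupleP: v => c v.
      by rewrite /= !drop0.
    all: computability.
  + move=> t t' v y tt' /bounded_searchP[yt fy hy]; apply/bounded_searchP; split.
    * exact: leq_trans tt'.
    * exact: mf fy.
    * move=> m /hy; case e: (Ef t _) => [//|z]; by rewrite (mf _ _ _ _ tt' e).
  + move=> v y /=; split.
      move=> [/sf[t0 h0] hm].
      have {}hm (m : 'I_y) : exists z, mu_eval f [tuple of val m :: v] z.+1.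
        exact: hm (ltn_ord m).
      have [z hz] := fin_all_exists hm.
      have [T hT] := fin_all_exists (fun m => (sf _ _).1 (hz m)).
      pose t := maxn y.+1 (maxn t0 (\max_i T i)).
      have tT i : T i <= t by rewrite !leq_max leq_bigmax !orbT.
      exists t; apply/bounded_searchP; split.
      * by rewrite leq_maxl.
      * by apply: mf h0; rewrite leq_max leq_maxl orbT.
      * by move=> m my; rewrite (mf _ _ _ _ (tT (Ordinal my)) (hT (Ordinal my))).
    move=> [t /bounded_searchP[yt fy hy]]; split; first by apply/sf; exists t.
    move=> m /hy; case e: (Ef t _) => [//|[//|z]] _; exists z.
    by apply/sf; exists t.
Qed.

(** * Strings as numbers *)

(** The inverse of [string_code]: the bits of the string of code a are the binary
    digits of a + 1, least significant first, without the leading digit. *)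
Definition string_of a : seq bool :=
  mkseq (fun i => odd (a.+1 %/ 2 ^ i)) (trunc_log 2 a.+1).

Lemma string_codeK : cancel string_code string_of.
Proof.
elim=> [|b s IH] /=; first by [].
rewrite -[in RHS]IH /string_of; set m := string_code s.
have -> : (b + m.*2).+2 = b + m.+1.*2 by lia.
have tE : trunc_log 2 (b + m.+1.*2) = (trunc_log 2 m.+1).+1.
  by rewrite trunc_log2S; [congr (trunc_log 2 _).+1|]; case: b; lia.
rewrite tE {tE} mkseq_cons expn0 divn1 oddD odd_double addbF oddb; congr cons.
by apply: eq_mkseq => i; rewrite expnS divnMA; congr (odd (_ %/ _)); case: b; lia.
Qed.

Lemma string_ofK : cancel string_of string_code.
Proof.
have [g gK Kg] := string_code_bij.
by move=> a; rewrite -{1}(Kg a) string_codeK Kg.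
Qed.

Lemma size_string_of a : size (string_of a) = trunc_log 2 a.+1.
Proof. by rewrite size_mkseq. Qed.

Lemma computable_size n f : computable n f ->
  computable n (fun v => size (string_of (f v))).
Proof.
apply: (@computable_app1 _ (fun a => size (string_of a))).
apply: (@eq_computable _ (fun v =>
    \sum_(0 <= i < (head 0 v).+1) (2 ^ i.+1 <= (head 0 v).+1))).
  move=> v; rewrite size_string_of; set m := (head 0 v).+1.
  rewrite (eq_bigr (fun i => nat_of_bool (i < trunc_log 2 m))).
    rewrite sum_ltn// ltnW//; apply: leq_trans (trunc_logP (isT : 1 < 2) _) => //.
    exact: ltn_expl.
  move=> i _; congr nat_of_bool; apply/idP/idP; first exact: trunc_log_max.
  move=> im; apply: leq_trans (trunc_logP (isT : 1 < 2) _) => //.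
  by rewrite leq_exp2l.
by computability.
Qed.

(** With the first bit most significant, the numerical order is the lexicographic
    order, and taking prefixes is a division. This is not the order of the digits
    in [string_code]. *)
Definition bin_value (s : seq bool) : nat :=
  \sum_(0 <= i < size s) nth false s i * 2 ^ (size s - i.+1).

Lemma bin_value_cons b s : bin_value (b :: s) = b * 2 ^ size s + bin_value s.
Proof. by rewrite /bin_value big_nat_recl//= subn1. Qed.

Lemma bin_value_rcons s b : bin_value (rcons s b) = (bin_value s).*2 + b.
Proof.
elim: s b => [|c s IH] b /=.
  by rewrite bin_value_cons [bin_value [::]]big_geq// expn0; lia.
by rewrite !bin_value_cons IH size_rcons expnS; lia.
Qed.

Lemma bin_value_lt s : bin_value s < 2 ^ size s.
Proof.
elim/last_ind: s => [|s b IH]; first by rewrite /bin_value big_geq.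
by rewrite bin_value_rcons size_rcons expnS; case: b; lia.
Qed.

Lemma bin_value_take s l : l <= size s ->
  bin_value (take l s) = bin_value s %/ 2 ^ (size s - l).
Proof.
elim/last_ind: s => [|s b IH] in l *; first by rewrite leqn0 => /eqP ->; rewrite divn1.
rewrite size_rcons leq_eqVlt => /predU1P[->|ls].
  by rewrite take_oversize ?size_rcons// subnn divn1.
rewrite -cats1 takel_cat// IH// cats1 bin_value_rcons subSn// expnS divnMA.
by congr (_ %/ _); case: b; lia.
Qed.

Lemma bin_value_inj s t : size s = size t -> bin_value s = bin_value t -> s = t.
Proof.
elim/last_ind: s t => [|s b IH] t; case/lastP: t => [|t c];
  rewrite ?size_rcons// => -[st]; rewrite !bin_value_rcons => e.
have bc : b = c by move: b c e => [] []; lia.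
by rewrite bc (IH t)//; move: e; rewrite bc; lia.
Qed.

Lemma bin_value_surj n j : j < 2 ^ n -> exists2 s, size s = n & bin_value s = j.
Proof.
elim: n j => [|n IH] j jn.
  by exists [::]; rewrite // [bin_value _]big_geq//; move: jn; rewrite expn0; lia.
have [|s sn sj] := IH j./2; first by move: jn; rewrite expnS; lia.
by exists (rcons s (odd j)); rewrite ?size_rcons ?sn// bin_value_rcons sj; lia.
Qed.

Lemma computable_bin_value n f : computable n f ->
  computable n (fun v => bin_value (string_of (f v))).
Proof.
apply: (@computable_app1 _ (fun a => bin_value (string_of a))).
apply: (@eq_computable _ (fun v =>
   \sum_(0 <= i < size (string_of (head 0 v))) odd ((head 0 v).+1 %/ 2 ^ i)
      * 2 ^ (size (string_of (head 0 v)) - i.+1))).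
  move=> v; rewrite /bin_value; apply: eq_big_nat => i.
  by rewrite size_string_of => /andP[_ im]; rewrite nth_mkseq.
computability.
- exact/computable_size/computable_head/tail_of_id.
- by apply: computable_odd; computability.
- by apply: computable_size; computability.
Qed.

Ltac computability_hook ::= first [apply: computable_size
  | apply: computable_bin_value | apply: computable_odd].

(** This pairing is chosen for its agreement with [string_code] on the strings
    0^e 1 s, see [string_code_tagged]. *)
Definition pair_code a b := (2 ^ a * b.*2.+1).-1.
Definition unpair1 c := logn 2 c.+1.
Definition unpair2 c := (c.+1 %/ 2 ^ unpair1 c)./2.

Lemma pair_codeK1 a b : unpair1 (pair_code a b) = a.
Proof.
rewrite /unpair1 prednK ?muln_gt0 ?expn_gt0// lognM ?expn_gt0//.
by rewrite pfactorK// logn_coprime ?addn0// coprime2n/= odd_double.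
Qed.

Lemma pair_codeK2 a b : unpair2 (pair_code a b) = b.
Proof.
rewrite /unpair2 pair_codeK1 prednK ?muln_gt0 ?expn_gt0//.
by rewrite mulKn ?expn_gt0//; lia.
Qed.

Lemma computable_unpair1 n f : computable n f ->
  computable n (fun v => unpair1 (f v)).
Proof.
apply: (@computable_app1 _ unpair1); pose a := fun v : seq nat => head 0 v.
apply: (@eq_computable _ (fun v => \sum_(0 <= i < (a v).+1)
   ((a v).+1 %/ 2 ^ i.+1 * 2 ^ i.+1 == (a v).+1))).
  move=> v; rewrite -/(a v) /unpair1.
  rewrite (eq_bigr (fun i => nat_of_bool (i < logn 2 (a v).+1))); last first.
    by move=> i _; rewrite -pfactor_dvdn// dvdn_eq.
  apply: sum_ltn; apply: leq_trans (dvdn_leq (ltn0Sn _) (pfactor_dvdnn 2 (a v).+1)).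
  by rewrite ltnW// ltn_expl.
by rewrite /a; computability.
Qed.

Lemma computable_unpair2 n f : computable n f ->
  computable n (fun v => unpair2 (f v)).
Proof.
move=> hf; have ? := computable_unpair1 hf.
apply: (@eq_computable _ (fun v => ((f v).+1 %/ 2 ^ unpair1 (f v)) %/ 2)).
  by move=> v; rewrite /unpair2 divn2.
by computability.
Qed.

Lemma computable_pair_code n f g : computable n f -> computable n g ->
  computable n (fun v => pair_code (f v) (g v)).
Proof.
move=> hf hg.
apply: (@eq_computable _ (fun v => (2 ^ f v * (2 * g v).+1).-1)).
  by move=> v; rewrite /pair_code mul2n.
by computability.
Qed.

(** * The stages of the construction *)

(** In this part [ev t p] is the result, at stage t, of the program with code p:
    0 if it has not halted yet, and 1 plus the code of the output otherwise.
    The codes less than 2^(t+1) - 1 are those of the strings of length at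
    most t. All quantities are integers, obtained by scaling with 2^t. *)
Section stages.
Variable ev : nat -> nat -> nat.

(** 2^t times 2^-K at stage t. Strings longer than t have weight 0 at stage t,
    which makes 0^(t+1) new at that stage. *)
Definition weight t a : nat :=
  (a < (2 ^ t.+1).-1) * \max_(0 <= p < (2 ^ t.+1).-1)
    (ev t p == a.+1) * 2 ^ (t - size (string_of p)).

(** 2^t times f_t(x), for any x whose first t bits have the value j. *)
Definition stage_sum t j : nat :=
  \sum_(0 <= a < (2 ^ t.+1).-1)
    (bin_value (string_of a) <= j %/ 2 ^ (t - size (string_of a))) * weight t a.

(** The last two conditions say that f_t(x) is within 2^-n of 0.w, where w is the
    output of p and n its length. Because of the bound k on n, the last kick
    that is blamed on p has size at most 2^-n. *)
Definition suspicious_for e k t j p : bool :=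
  let a := (ev t p).-1 in
  [&& 0 < ev t p, size (string_of p) + (4 * e + 4) <= size (string_of a),
    size (string_of a) <= k,
    bin_value (string_of a) * 2 ^ t
      <= 2 ^ size (string_of a) * stage_sum t j + 2 ^ t &
    2 ^ size (string_of a) * stage_sum t j
      <= (bin_value (string_of a)).+1 * 2 ^ t].

Definition suspicious e k t j : bool :=
  has (fun p => suspicious_for e k t j p) (iota 0 (2 ^ t.+1).-1).

Definition suspicious_count e k t : nat :=
  \sum_(0 <= j < 2 ^ t) suspicious e k t j.

(** U has described the string 0^m of the last kick with at most k + 2e bits; until
    this happens, k is the exponent of that kick. The value m = 0 stands for the
    absence of kicks. *)
Definition confirmed e t k m : bool :=
  (m == 0) || (2 ^ t <= weight t (2 ^ m).-1 * 2 ^ (k + 2 * e)).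

Definition alarm e t k : bool := 2 ^ t < 2 ^ e * suspicious_count e k t.

(** The state (k, w, m) of process e consists of the exponent k of the kicks, the
    total size w * 2^-k of the kicks so far, and the length m of the string
    described by the last one. Nothing happens until that string is confirmed.
    Then either there is a kick, or k is incremented; with a larger k more
    programs count as sources of suspicion. Since k never decreases, the next
    kick can use the program of length k and value w, as in the Kraft-Chaitin
    construction for an ordered list of requests. *)
Definition step e t (s : nat * nat * nat) : nat * nat * nat :=
  let: (k, w, m) := s in
  if confirmed e t k m then
    if alarm e t k then (k, w.+1, t.+1) else (k.+1, w.*2, m)
  else s.

Definition state e t := iteri t (step e) (0, 0, 0).
Definition st_exp e t := (state e t).1.1.
Definition st_used e t := (state e t).1.2.
Definition st_pend e t := (state e t).2.
Definition is_kick e t : bool :=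
  confirmed e t (st_exp e t) (st_pend e t) && alarm e t (st_exp e t).

Hypothesis ev_computable :
  computable 2 (fun u => ev (head 0 u) (head 0 (behead u))).

Let ev_c n f g : computable n f -> computable n g ->
  computable n (fun v => ev (f v) (g v)).
Proof. exact: (computable_app2 (F := ev)). Qed.

Let weight_c n f g : computable n f -> computable n g ->
  computable n (fun v => weight (f v) (g v)).
Proof.
apply: (computable_app2 (F := weight)); rewrite /weight.
by computability; apply: ev_c; computability.
Qed.

Let stage_sum_c n f g : computable n f -> computable n g ->
  computable n (fun v => stage_sum (f v) (g v)).
Proof.
apply: (computable_app2 (F := stage_sum)); rewrite /stage_sum.
by computability; apply: weight_c; computability.
Qed.

Ltac computability_hook ::= first [ apply: ev_c | apply: weight_c
  | apply: stage_sum_c | apply: computable_size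
  | apply: computable_bin_value | apply: computable_odd
  | apply: computable_unpair1 | apply: computable_unpair2
  | apply: computable_pair_code].

Let suspicious_c n f g h k : computable n f -> computable n g ->
  computable n h -> computable n k ->
  computable n (fun v => suspicious (f v) (g v) (h v) (k v)).
Proof.
apply: (computable_app4 (F := suspicious)); rewrite /suspicious /suspicious_for.
by computability.
Qed.

Let alarm_c n f g h : computable n f -> computable n g -> computable n h ->
  computable n (fun v => alarm (f v) (g v) (h v)).
Proof.
apply: (computable_app3 (F := alarm)); rewrite /alarm /suspicious_count.
by do 3! (try apply: suspicious_c; computability).
Qed.

Let confirmed_c n f g h k : computable n f -> computable n g ->
  computable n h -> computable n k ->
  computable n (fun v => confirmed (f v) (g v) (h v) (k v)).
Proof.
apply: (computable_app4 (F := confirmed)); rewrite /confirmed.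
by computability.
Qed.

Let code3 (s : nat * nat * nat) := pair_code s.1.1 (pair_code s.1.2 s.2).
Let state_code e t := code3 (state e t).

Ltac computability_hook ::= first [ apply: confirmed_c | apply: alarm_c
  | apply: computable_unpair1 | apply: computable_unpair2
  | apply: computable_pair_code].

Let state_code_c n f g : computable n f -> computable n g ->
  computable n (fun v => state_code (f v) (g v)).
Proof.
apply: (computable_app2 (F := state_code)).
pose k c := unpair1 c; pose w c := unpair1 (unpair2 c); pose m c := unpair2 (unpair2 c).
apply: (@eq_computable _ (fun v => iteri (head 0 (behead v))
  (fun t c => if confirmed (head 0 v) t (k c) (m c)
     then if alarm (head 0 v) t (k c)
        then pair_code (k c) (pair_code (w c).+1 t.+1)
        else pair_code (k c).+1 (pair_code (2 * w c) (m c))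
     else c) (pair_code 0 (pair_code 0 0)))).
  move=> v; rewrite /state_code /state; elim: (head 0 (behead v)) => [//|t IH].
  rewrite 2!iteriS IH; case: (iteri t _ _) => [[k0 w0] m0] /=.
  rewrite /k /w /m /code3 /= !(pair_codeK1, pair_codeK2).
  by case: ifP => // _; case: ifP => //= _; rewrite mul2n.
rewrite /k /w /m.
by computability.
Qed.

Let st_exp_c n f g : computable n f -> computable n g ->
  computable n (fun v => st_exp (f v) (g v)).
Proof.
move=> hf hg; apply: (@eq_computable _ (fun v => unpair1 (state_code (f v) (g v)))).
  by move=> v; rewrite pair_codeK1.
by apply/computable_unpair1/state_code_c.
Qed.

Let st_used_c n f g : computable n f -> computable n g ->
  computable n (fun v => st_used (f v) (g v)).
Proof.
move=> hf hg; apply: (@eq_computable _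
  (fun v => unpair1 (unpair2 (state_code (f v) (g v))))).
  by move=> v; rewrite pair_codeK2 pair_codeK1.
by apply/computable_unpair1/computable_unpair2/state_code_c.
Qed.

Let st_pend_c n f g : computable n f -> computable n g ->
  computable n (fun v => st_pend (f v) (g v)).
Proof.
move=> hf hg; apply: (@eq_computable _
  (fun v => unpair2 (unpair2 (state_code (f v) (g v))))).
  by move=> v; rewrite !pair_codeK2.
by apply/computable_unpair2/computable_unpair2/state_code_c.
Qed.

Let kick_c n f g : computable n f -> computable n g ->
  computable n (fun v => is_kick (f v) (g v)).
Proof.
move=> hf hg; have := st_exp_c hf hg; have := st_pend_c hf hg => ? ?.
by rewrite /is_kick; computability.
Qed.

(** p is the code of the string 0^e 1 s, where s has length k and value w for the
    state (k, w, m) of process e at the kick. *)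
Definition kick_match t p : bool :=
  let e := unpair1 p in let r := unpair2 p in
  [&& 0 < r, is_kick e t, st_exp e t == size (string_of r.-1) &
    st_used e t == bin_value (string_of r.-1)].

Ltac computability_hook ::= first [ apply: kick_c | apply: st_exp_c
  | apply: st_used_c | apply: computable_size | apply: computable_bin_value
  | apply: computable_unpair1 | apply: computable_unpair2].

Lemma kick_match_c : computable 2
  (fun u => ~~ kick_match (head 0 u) (head 0 (behead u))).
Proof.
by rewrite /kick_match; computability.
Qed.

Lemma kick_machine_code : exists c : mu_rec 1, forall p y,
  mu_eval c [tuple p] y <-> exists t, [/\ kick_match t p,
    forall t', t' < t -> ~~ kick_match t' p & y = (2 ^ t.+1).-1].
Proof.
have [c cP] := kick_match_c.
have [d dP] : computable 1 (fun v => (2 ^ (head 0 v).+1).-1) by computability.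
exists (Comp d (fun=> Mu c)) => p y /=; split.
  move=> [w [/(_ ord0)[/cP/= w0 hw] /dP yE]]; exists (thead w); split.
  - by move: w0; rewrite /thead; case: kick_match.
  - by move=> t' /hw[z /cP/=]; case: kick_match.
  - by rewrite yE; case/tupleP: w {w0 hw yE}.
move=> [t [h1 h2 ->]]; exists [tuple t]; split; last exact/dP.
move=> i; rewrite (ord1 i) /tnth/=; split.
  by apply/cP; rewrite /= h1.
by move=> m /h2 h; exists 0; apply/cP; rewrite /= h.
Qed.

End stages.

(** * The kick machine *)

Lemma ltn_string_code s t : (string_code s < (2 ^ t.+1).-1) = (size s <= t).
Proof.
have : 0 < 2 ^ t.+1 by rewrite expn_gt0.
rewrite -{2}(string_codeK s) size_string_of; set m := string_code s => p0.
have -> : (m < (2 ^ t.+1).-1) = (m.+1 < 2 ^ t.+1) by lia.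
rewrite -[RHS]ltnS; apply/idP/idP => h.
  rewrite -(ltn_exp2l (m := 2))//; apply: leq_ltn_trans h.
  exact: trunc_logP.
apply: leq_trans (trunc_log_ltn m.+1 (isT : 1 < 2)) _.
by rewrite leq_exp2l.
Qed.

Lemma string_code_nseq n : string_code (nseq n false) = (2 ^ n).-1.
Proof. by elim: n => [//|n /= ->]; rewrite expnS; have := expn_gt0 2 n; lia. Qed.

Lemma string_code_tagged e s :
  string_code (nseq e false ++ true :: s) = pair_code e (string_code s).+1.
Proof.
rewrite /pair_code; elim: e => [|e /= ->]; first by rewrite /=; lia.
rewrite expnS -mulnA; set m := 2 ^ e * _.
have : 0 < m by rewrite muln_gt0 expn_gt0.
by lia.
Qed.

Lemma unpairK c : pair_code (unpair1 c) (unpair2 c) = c.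
Proof.
rewrite /pair_code /unpair2; set e := unpair1 c.
have [q qE] : exists q, c.+1 = 2 ^ e * q.
  by have /dvdnP[q ->] := pfactor_dvdnn 2 c.+1; exists q; rewrite mulnC.
have e0 : 0 < 2 ^ e by rewrite expn_gt0.
have : odd q.
  apply/negPn/negP => qe.
  have : 2 ^ e.+1 %| c.+1 by rewrite qE expnSr dvdn_pmul2l// dvdn2.
  by rewrite pfactor_dvdn// ltnn.
move=> qo; rewrite qE mulKn//.
have -> : (q./2).*2.+1 = q by lia.
by rewrite -qE.
Qed.

Lemma untag_string s : 0 < unpair2 (string_code s) ->
  s = nseq (unpair1 (string_code s)) false ++
      true :: string_of (unpair2 (string_code s)).-1.
Proof.
move=> r0; apply: (can_inj string_codeK).
by rewrite string_code_tagged string_ofK prednK// unpairK.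
Qed.

Lemma prefix_tagged e e' s s' :
  prefix (nseq e false ++ true :: s) (nseq e' false ++ true :: s') ->
  e = e' /\ prefix s s'.
Proof.
elim: e e' => [|e IH] [|e'] //=; rewrite ?eqxx//=.
by move/IH => [-> ->].
Qed.

Lemma prefix_bin_value s s' : prefix s s' ->
  bin_value s = bin_value s' %/ 2 ^ (size s' - size s).
Proof.
by move=> /prefixP[u ->]; rewrite -bin_value_take ?size_cat ?leq_addr// take_size_cat.
Qed.

Section machine.
Variable ev : nat -> nat -> nat.

Local Notation kx := (st_exp ev).
Local Notation us := (st_used ev).
Local Notation pd := (st_pend ev).
Local Notation kick := (is_kick ev).

Lemma state_step e t : 
  [\/ [/\ kick e t, kx e t.+1 = kx e t, us e t.+1 = (us e t).+1 & pd e t.+1 = t.+1],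
   [/\ ~~ kick e t, confirmed ev e t (kx e t) (pd e t),
     kx e t.+1 = (kx e t).+1, us e t.+1 = (us e t).*2 & pd e t.+1 = pd e t] |
   [/\ ~~ kick e t, ~~ confirmed ev e t (kx e t) (pd e t), kx e t.+1 = kx e t,
      us e t.+1 = us e t & pd e t.+1 = pd e t]].
Proof.
rewrite /is_kick /st_exp /st_used /st_pend /state iteriS.
case: (iteri t _ _) => [[k w] m] /=.
case: ifP => hc /=; last by constructor 3.
by case: ifP => ha; [constructor 1|constructor 2].
Qed.

(** The total size of the kicks does not decrease, and it increases by the full
    size of the kick at t, if there is one. *)
Lemma state_mono e t t' : t <= t' -> kx e t <= kx e t' /\
  (us e t + kick e t * (t < t')) * 2 ^ (kx e t' - kx e t) <= us e t'.
Proof.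
elim: t' => [|t' IH].
  by rewrite leqn0 => /eqP ->; rewrite subnn ltnn muln0 addn0 muln1.
rewrite leq_eqVlt => /predU1P[->|]; first by rewrite ltnn muln0 addn0 subnn muln1.
rewrite ltnS => tt'; have [kk uu] := IH tt'; rewrite tt' muln1.
move: tt' uu; rewrite leq_eqVlt => /predU1P[<-{t' IH kk} _|->].
  have [[-> -> -> _]|[/negbTE-> _ -> -> _]|[/negbTE-> _ -> -> _]] := state_step e t.
  - by rewrite subnn muln1 addn1.
  - by rewrite leqnSn addn0 subSnn expn1 muln2.
  - by rewrite addn0 subnn muln1.
rewrite muln1 => uu; have [[_ -> -> _]|[_ _ -> -> _]|[_ _ -> -> _]] := state_step e t' => //.
  by split=> //; rewrite (leq_trans uu).
by rewrite (leq_trans kk)// subSn// expnS mulnCA mul2n leq_double.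
Qed.

(** The intervals of length 2^-k and left end w * 2^-k that belong to the kicks
    lie side by side from left to right, so that their programs are not nested. *)
Lemma kick_disjoint e t t' : kick e t -> kick e t' -> kx e t <= kx e t' ->
  us e t = us e t' %/ 2 ^ (kx e t' - kx e t) -> kx e t = kx e t' /\ t' <= t.
Proof.
move=> kt kt' kk uu; have [t't|tt'] := leqP t' t.
  by split=> //; apply/eqP; rewrite eqn_leq kk (state_mono e t't).1.
have [_] := state_mono e (ltnW tt').
by rewrite kt tt' muln1 -leq_divRL ?expn_gt0// -uu addn1 ltnn.
Qed.

Definition kick_machine (s : seq bool) : option (seq bool) :=
  if pselect (exists t, kick_match ev t (string_code s)) is left h
  then Some (nseq (ex_minn h).+1 false) else None.

Hypothesis ev_computable :
  computable 2 (fun u => ev (head 0 u) (head 0 (behead u))).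

Lemma kick_machine_prefix_free : prefix_free_machine kick_machine.
Proof.
split.
  have [c cP] := kick_machine_code ev_computable.
  exists c => s u; rewrite cP /kick_machine; case: pselect => [h|h].
    case: ex_minnP => t ht tmin; split=> [[<-]|[t' [ht' t'min /esym ue]]].
      exists t; rewrite -[false :: _]/(nseq t.+1 false) string_code_nseq; split=> // t' t't.
      by apply/negP => /tmin; rewrite leqNgt t't.
    rewrite -string_code_nseq in ue; rewrite -(can_inj string_codeK ue).
    congr (Some (nseq _.+1 _)); apply/eqP; rewrite eqn_leq tmin// leqNgt.
    by apply/negP => /t'min; rewrite ht.
  by split=> // -[t [ht _ _]]; case: h; exists t.
move=> s s'; rewrite /kick_machine.
case: pselect => // -[t /and4P[r kt /eqP kE /eqP uE]] _.
case: pselect => // -[t' /and4P[r' kt' /eqP kE' /eqP uE']] _.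
rewrite (untag_string r) (untag_string r') => /prefix_tagged[ee pp].
have pv := prefix_bin_value pp; have ps := size_prefix pp.
rewrite -ee in kt' kE' uE'.
have [||kk _] := kick_disjoint kt kt'; first by rewrite kE kE'.
  by rewrite uE uE' kE kE'.
rewrite ee; congr (_ ++ _ :: _); apply: bin_value_inj; first by rewrite -kE -kE'.
by rewrite pv -kE -kE' kk subnn divn1.
Qed.

Lemma kick_machine_program e t : kick e t -> us e t < 2 ^ kx e t ->
  exists2 s, kick_machine s = Some (nseq t.+1 false) & size s = e + (kx e t).+1.
Proof.
move=> kt /bin_value_surj[r rk ru].
pose s := nseq e false ++ true :: r.
have st : kick_match ev t (string_code s).
  rewrite /kick_match /s string_code_tagged pair_codeK1 pair_codeK2 kt.
  by rewrite string_codeK rk ru !eqxx.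
exists s; last by rewrite /s size_cat size_nseq /= rk.
rewrite /kick_machine; case: pselect => [h|]; last by case; exists t.
congr (Some (nseq _.+1 _)); case: ex_minnP => t' + /(_ _ st) t't.
rewrite /kick_match /s string_code_tagged pair_codeK1 pair_codeK2.
rewrite string_codeK /= rk ru => /and3P[kt' /eqP kE /eqP uE].
apply/eqP; rewrite eqn_leq t't /=.
have [] := @kick_disjoint e t' t kt' kt; rewrite ?kE//.
by rewrite subnn divn1 uE.
Qed.

End machine.

(** * Stage weights and the Kraft inequality *)

Lemma ltn_num_strings a t : (a < (2 ^ t.+1).-1) = (size (string_of a) <= t).
Proof. by rewrite -ltn_string_code string_ofK. Qed.

Definition prefix_value (x : nat -> bool) n := bin_value (mkseq x n).

Lemma prefix_value_div x n m : n <= m ->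
  prefix_value x m %/ 2 ^ (m - n) = prefix_value x n.
Proof.
move=> nm; have := @bin_value_take (mkseq x m) n; rewrite size_mkseq => <-//.
rewrite /prefix_value; congr bin_value; apply: (@eq_from_nth _ false).
  by rewrite size_takel size_mkseq.
rewrite size_takel ?size_mkseq// => i im.
by rewrite nth_take// !nth_mkseq// (leq_trans im).
Qed.

Lemma sum_div d (F : nat -> nat) m : 0 < d ->
  \sum_(0 <= j < d * m) F (j %/ d) = d * \sum_(0 <= i < m) F i.
Proof.
move=> d0; elim: m => [|m IH]; first by rewrite !big_geq ?muln0.
rewrite (big_cat_nat (n := d * m)) ?leq_mul2l ?leqnSn ?orbT//=.
rewrite IH big_nat_recr//= mulnDr; congr addn.
rewrite (eq_big_nat _ _ (F2 := fun=> F m)).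
  by rewrite sum_nat_const_nat -mulnBr subSnn muln1.
move=> j /andP[j1 j2]; congr F; apply/eqP; rewrite eqn_leq.
by rewrite leq_divRL// mulnC j1 andbT -ltnS ltn_divLR// mulnC.
Qed.

Lemma sum_unique m n (P : pred nat) : (forall i j, P i -> P j -> i = j) ->
  \sum_(m <= i < n) P i <= 1.
Proof.
move=> inj; have [/hasP[i im Pi]|/hasPn h] := boolP (has P (index_iota m n)).
  rewrite (big_rem i)//= Pi big_seq big1// => j.
  rewrite mem_rem_uniq ?iota_uniq// inE => /andP[ji _].
  by case: (boolP (P j)) => // Pj; rewrite (inj _ _ Pj Pi) eqxx in ji.
by rewrite big_seq big1// => i /h /negbTE ->.
Qed.

Section weights.
Variable ev : nat -> nat -> nat.
Hypothesis ev_mono : forall t t' p y, t <= t' -> ev t p = y.+1 -> ev t' p = y.+1.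
Hypothesis ev_prefix_free : forall t p p', 0 < ev t p -> 0 < ev t p' ->
  prefix (string_of p) (string_of p') -> p = p'.

Lemma weight_ge t a p : ev t p = a.+1 -> size (string_of p) <= t ->
  size (string_of a) <= t -> 2 ^ (t - size (string_of p)) <= weight ev t a.
Proof.
move=> pa pt at_; rewrite /weight ltn_num_strings at_ mul1n.
rewrite (big_rem p)/=; last by rewrite mem_index_iota ltn_num_strings.
by rewrite pa eqxx mul1n leq_maxl.
Qed.

Lemma weight_attained t a : weight ev t a = 0 \/ exists p,
  [/\ ev t p = a.+1, size (string_of p) <= t, size (string_of a) <= t &
    weight ev t a = 2 ^ (t - size (string_of p))].
Proof.
rewrite /weight ltn_num_strings; case: leqP => at_; last by left.
rewrite mul1n big_seq.
apply: (big_ind (fun w => w = 0 \/ exists p,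
  [/\ ev t p = a.+1, size (string_of p) <= t, true &
    w = 2 ^ (t - size (string_of p))])); first by left.
  by move=> w w' hw hw'; rewrite /maxn; case: ifP.
move=> p; rewrite mem_index_iota ltn_num_strings /= => pt.
by case: eqP => pa; [right; exists p; rewrite mul1n|left].
Qed.

Lemma weight_double t a : 2 * weight ev t a <= weight ev t.+1 a.
Proof.
case: (weight_attained t a) => [->|[p [pa pt at_ ->]]]; first by rewrite muln0.
rewrite -expnS -subSn//.
by apply: weight_ge; rewrite ?leqW// (ev_mono _ pa).
Qed.

Lemma weight_eq0 t a : t < size (string_of a) -> weight ev t a = 0.
Proof. by rewrite /weight ltn_num_strings ltnNge => /negbTE ->. Qed.

Definition path_sum t x := stage_sum ev t (prefix_value x t).

(** In this form the range of summation can be the same for two stages. *)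
Lemma path_sumE N t x : t <= N -> path_sum t x =
  \sum_(0 <= a < (2 ^ N.+1).-1)
     (bin_value (string_of a) <= prefix_value x (size (string_of a))) *
     weight ev t a.
Proof.
move=> tN; have tN2 : (2 ^ t.+1).-1 <= (2 ^ N.+1).-1.
  have : 2 ^ t.+1 <= 2 ^ N.+1 by rewrite leq_exp2l.
  by lia.
rewrite [RHS](big_cat_nat (n := (2 ^ t.+1).-1))//=.
rewrite [X in _ + X](_ : _ = 0); last first.
  rewrite big_nat_cond big1// => a /andP[/andP[+ _] _].
  by rewrite leqNgt ltn_num_strings -ltnNge => /weight_eq0 ->; rewrite muln0.
rewrite addn0 /path_sum /stage_sum; apply: eq_big_nat => a /andP[_].
by rewrite ltn_num_strings => /prefix_value_div ->.
Qed.

(** If weights only grow, the sum grows at least as much as any one of its terms.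
    The factors 2 come from the scaling by 2^t. *)
Lemma path_sum_step t x a :
    bin_value (string_of a) <= prefix_value x (size (string_of a)) ->
  2 * path_sum t x + weight ev t.+1 a <= path_sum t.+1 x + 2 * weight ev t a.
Proof.
move=> ax; have [at_|ta] := leqP (size (string_of a)) t.+1; last first.
  rewrite !weight_eq0//; last by rewrite ltnW.
  rewrite (path_sumE x (leqnSn t)) (path_sumE x (leqnn t.+1)) addn0 muln0 addn0.
  rewrite big_distrr leq_sum//= => b _.
  by rewrite mulnCA leq_mul2l weight_double orbT.
rewrite (path_sumE x (leqnSn t)) (path_sumE x (leqnn t.+1)).
have am : a \in index_iota 0 (2 ^ t.+2).-1 by rewrite mem_index_iota ltn_num_strings.
rewrite (big_rem a)//= [X in _ <= X + _](big_rem a)//= ax !mul1n mulnDr.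
set X := \sum_(b <- _) _ * weight ev t b; set Y := \sum_(b <- _) _ * weight ev t.+1 b.
suff : 2 * X <= Y by lia.
rewrite big_distrr leq_sum//= => b _.
by rewrite mulnCA leq_mul2l weight_double orbT.
Qed.

(** Count the j < 2^t that extend a halting program; by prefix-freeness no j
    extends two of them. *)
Lemma kraft t : \sum_(0 <= p < (2 ^ t.+1).-1)
  (0 < ev t p) * 2 ^ (t - size (string_of p)) <= 2 ^ t.
Proof.
pose own p j := (0 < ev t p) &&
  (j %/ 2 ^ (t - size (string_of p)) == bin_value (string_of p)).
have ownE p : p < (2 ^ t.+1).-1 ->
    (0 < ev t p) * 2 ^ (t - size (string_of p)) = \sum_(0 <= j < 2 ^ t) own p j.
  rewrite ltn_num_strings => pt; case: (boolP (0 < ev t p)) => hp; last first.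
    by rewrite big1// => j _; rewrite /own (negbTE hp).
  have tE : 2 ^ t = 2 ^ (t - size (string_of p)) * 2 ^ size (string_of p).
    by rewrite -expnD subnK.
  rewrite tE /own hp /=.
  rewrite (sum_div (fun i => nat_of_bool (i == bin_value (string_of p))) _) ?expn_gt0//.
  rewrite (eq_bigr (fun i => if i == bin_value (string_of p) then 1 else 0)).
    by rewrite -big_mkcond big_nat1_eq bin_value_lt mul1n muln1.
  by move=> i _; case: eqP.
rewrite (eq_big_nat _ _ (F2 := fun p => \sum_(0 <= j < 2 ^ t) own p j)); last first.
  by move=> p /andP[_ ]; exact: ownE.
rewrite exchange_big_nat/=.
apply: (@leq_trans (\sum_(0 <= j < 2 ^ t) 1)); last first.
  by rewrite sum_nat_const_nat subn0 muln1.
apply: leq_sum => j _.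
have own_inj p p' : size (string_of p') <= t -> own p j -> own p' j ->
    size (string_of p) <= size (string_of p') -> p = p'.
  move=> p't /andP[hp /eqP pj] /andP[hp' /eqP pj'] pp'.
  apply: ev_prefix_free hp hp' _.
  apply/prefixP; exists (drop (size (string_of p)) (string_of p')).
  rewrite -[LHS](cat_take_drop (size (string_of p))); congr (_ ++ _).
  apply: bin_value_inj; first by rewrite size_takel.
  rewrite bin_value_take// -pj -pj' -divnMA -expnD; congr (_ %/ 2 ^ _).
  by lia.
rewrite (eq_big_nat _ _ (F2 := fun p =>
    nat_of_bool [&& size (string_of p) <= t & own p j])).
  apply: sum_unique => p p' /andP[pt po] /andP[p't po'].
  by case/orP: (leq_total (size (string_of p)) (size (string_of p'))) => h;
    [exact: own_inj|exact/esym/own_inj].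
by move=> p /andP[_]; rewrite ltn_num_strings => ->.
Qed.

Lemma stage_sum_le t j : stage_sum ev t j <= 2 ^ t.
Proof.
apply: leq_trans (kraft t).
apply: (@leq_trans (\sum_(0 <= a < (2 ^ t.+1).-1) \sum_(0 <= p < (2 ^ t.+1).-1)
    (ev t p == a.+1) * 2 ^ (t - size (string_of p)))).
  apply: leq_sum => a _; apply: (@leq_trans (weight ev t a)).
    by rewrite -[X in _ <= X]mul1n leq_mul2r leq_b1 orbT.
  case: (weight_attained t a) => [->//|[p [pa pt _ ->]]].
  rewrite (big_rem p) ?mem_index_iota ?ltn_num_strings//= pa eqxx mul1n.
  exact: leq_addr.
rewrite exchange_big_nat; apply: leq_sum => p _; rewrite -big_distrl leq_mul2r.
apply/orP; right; case: (ev t p) => [|y]; first by rewrite big1.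
by apply: sum_unique => a b /eqP-> /eqP[].
Qed.

End weights.

Import Order.TTheory GRing.Theory Num.Theory.

(** * The kicks have total size less than 1 *)

Section accounting.
Local Open Scope ring_scope.
Variable R : realFieldType.
Variable ev : nat -> nat -> nat.
Hypothesis ev_mono : forall t t' p y,
  (t <= t')%N -> ev t p = y.+1 -> ev t' p = y.+1.
Hypothesis ev_prefix_free : forall t p p', (0 < ev t p)%N -> (0 < ev t p')%N ->
  prefix (string_of p) (string_of p') -> p = p'.

Local Notation kx := (st_exp ev).
Local Notation us := (st_used ev).
Local Notation pd := (st_pend ev).
Local Notation kick := (is_kick ev).

Lemma expr2_gt0 n : 0 < 2 ^+ n :> R. Proof. by rewrite exprn_gt0. Qed.
Hint Resolve expr2_gt0 : core.
Lemma expr2_ge0 n : 0 <= 2 ^+ n :> R. Proof. exact: ltW. Qed.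
Hint Resolve expr2_ge0 : core.
Lemma expr2_neq0 n : 2 ^+ n != 0 :> R. Proof. exact: lt0r_neq0. Qed.
Hint Resolve expr2_neq0 : core.

Definition path_value t x : R := (path_sum ev t x)%:R / 2 ^+ t.
Definition rweight t m : R := (weight ev t (2 ^ m).-1)%:R / 2 ^+ t.
Definition spent e t : R := (us e t)%:R / 2 ^+ kx e t.
Definition kick_size e t : R := if kick e t then 2 ^- kx e t else 0.
(** The part of the last kick that U still has to turn into growth of f, scaled so
    that a debt of 0 means that the kick is confirmed. *)
Definition debt e t : R :=
  if pd e t == 0%N then 0
  else Num.max 0 (2 ^- kx e t - 2 ^+ (2 * e) * rweight t (pd e t)).

Lemma spent_step e t : spent e t.+1 = spent e t + kick_size e t.
Proof.
rewrite /spent /kick_size.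
have [[-> -> -> _]|[/negbTE-> _ -> -> _]|[/negbTE-> _ -> -> _]] := state_step ev e t.
- by rewrite -natr1 mulrDl mul1r.
- by rewrite exprS -mul2n natrM addr0 -mulf_div divff ?mul1r// pnatr_eq0.
- by rewrite addr0.
Qed.

Lemma spentE e t : spent e t = \sum_(0 <= u < t) kick_size e u.
Proof.
elim: t => [|t IH]; last by rewrite spent_step big_nat_recr//= IH.
by rewrite big_geq// /spent mul0r.
Qed.

Lemma path_value_step t x m : path_value t x + rweight t.+1 m <= path_value t.+1 x + rweight t m.
Proof.
have := @path_sum_step ev ev_mono t x (2 ^ m).-1.
rewrite -string_code_nseq string_codeK.
have -> : bin_value (nseq m false) = 0%N.
  by elim: m => [|m IH]; rewrite ?bin_value_cons ?[bin_value [::]]big_geq.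
rewrite string_code_nseq => /(_ isT).
have cast (a b c d : nat) : (2 * a + b <= c + 2 * d)%N ->
  2 * a%:R + b%:R <= c%:R + 2 * d%:R :> R by rewrite -!natrM -!natrD ler_nat.
move=> /cast h; rewrite /path_value /rweight exprS invfM.
have i0 : 0 < (2 ^+ t)^-1 :> R by rewrite invr_gt0.
by move: h; rewrite -(ler_pM2r i0); lra.
Qed.

Lemma rweight_fresh t : rweight t t.+1 = 0.
Proof.
by rewrite /rweight weight_eq0 ?mul0r// -string_code_nseq string_codeK size_nseq.
Qed.

Lemma rweight_ge0 t m : 0 <= rweight t m.
Proof. by rewrite divr_ge0. Qed.

Lemma path_value_mono t t' x : (t <= t')%N -> path_value t x <= path_value t' x.
Proof.
move=> /subnK <-; elim: (t' - t)%N => [//|d IH]; apply: le_trans IH _.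
have := path_value_step (d + t) x (d + t).+1; rewrite rweight_fresh addr0 addSn.
by apply: le_trans; rewrite lerDl rweight_ge0.
Qed.

Lemma debt_ge0 e t : 0 <= debt e t.
Proof. by rewrite /debt; case: ifP => // _; rewrite le_max lexx. Qed.

Lemma confirmed_debt e t : confirmed ev e t (kx e t) (pd e t) -> debt e t = 0.
Proof.
rewrite /confirmed /debt; case: eqP => //= _ h; apply/max_idPl.
rewrite subr_le0 /rweight -(ler_pM2r (expr2_gt0 (kx e t + t))).
move: h; rewrite -(ler_nat R) natrM !natrX !exprD.
have -> : 2 ^- kx e t * (2 ^+ kx e t * 2 ^+ t) = 2 ^+ t :> R by rewrite mulKf.
move=> /le_trans; apply; rewrite le_eqVlt; apply/orP; left; apply/eqP.
by field.
Qed.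

(** Every kick is eventually matched by growth of f(x), up to the factor 2^(2e)
    and up to the debt, which only covers the last kick. *)
Lemma potential_step e t x :
  2 ^+ (2 * e) * path_value t x - spent e t + debt e t <=
  2 ^+ (2 * e) * path_value t.+1 x - spent e t.+1 + debt e t.+1.
Proof.
rewrite spent_step /kick_size.
have c0 := expr2_gt0 (2 * e).
have mono : 2 ^+ (2 * e) * path_value t x <= 2 ^+ (2 * e) * path_value t.+1 x.
  by rewrite ler_pM2l// path_value_mono.
have rstep m : 2 ^+ (2 * e) * path_value t x + 2 ^+ (2 * e) * rweight t.+1 m <=
    2 ^+ (2 * e) * path_value t.+1 x + 2 ^+ (2 * e) * rweight t m.
  by rewrite -!mulrDr ler_pM2l// path_value_step.
have max0 (A : R) : 0 <= Num.max 0 A by rewrite le_max lexx.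
have maxA (A : R) : A <= Num.max 0 A by rewrite le_max lexx orbT.
have := state_step ev e t; case.
- move=> [kt kE _ pE]; rewrite kt.
  have /confirmed_debt -> : confirmed ev e t (kx e t) (pd e t) by case/andP: kt.
  have := rstep t.+1; rewrite rweight_fresh mulr0 /debt pE kE /=.
  by have := maxA (2 ^- kx e t - 2 ^+ (2 * e) * rweight t.+1 t.+1); lra.
- move=> [/negbTE -> /confirmed_debt -> _ _ _].
  by have := debt_ge0 e t.+1; lra.
- move=> [/negbTE -> _ kE _ pE]; rewrite /debt pE kE; case: eqP => _; first by lra.
  have := rstep (pd e t); set b := 2 ^+ (2 * e) * rweight t.+1 _.
  set a := 2 ^+ (2 * e) * rweight t _ => h.
  have m0 := max0 (2 ^- kx e t - b); have mA := maxA (2 ^- kx e t - b).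
  suff : Num.max 0 (2 ^- kx e t - a) <= 2 ^+ (2 * e) * path_value t.+1 x
      - 2 ^+ (2 * e) * path_value t x + Num.max 0 (2 ^- kx e t - b) by lra.
  by rewrite ge_max; apply/andP; split; lra.
Qed.

(** At the time of a kick there is no debt. *)
Lemma spent_le_path_value e t t' x : kick e t -> kick e t' -> (t <= t')%N ->
  spent e t' - spent e t <= 2 ^+ (2 * e) * (path_value t' x - path_value t x).
Proof.
move=> kt kt' tt'; rewrite mulrBr.
have : 2 ^+ (2 * e) * path_value t x - spent e t + debt e t <=
       2 ^+ (2 * e) * path_value t' x - spent e t' + debt e t'.
  move: tt' => /subnK <-; elim: (t' - t)%N => [//|d IH].
  by apply: le_trans IH _; exact: potential_step.
rewrite !confirmed_debt; [lra|by case/andP: kt'|by case/andP: kt].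
Qed.

Lemma suspicious_forP e k t x p a : ev t p = a.+1 ->
  suspicious_for ev e k t (prefix_value x t) p ->
  [/\ (size (string_of p) + (4 * e + 4) <= size (string_of a))%N,
      (size (string_of a) <= k)%N,
      (bin_value (string_of a))%:R / 2 ^+ size (string_of a)
        - 2 ^- size (string_of a) <= path_value t x &
      path_value t x <= (bin_value (string_of a))%:R / 2 ^+ size (string_of a)
        + 2 ^- size (string_of a)].
Proof.
move=> pa; rewrite /suspicious_for pa /= -/(path_sum ev t x).
set b := bin_value _; set n := size (string_of a) => /and4P[-> -> h3 h4].
have {}h3 : b%:R * 2 ^+ t <= 2 ^+ n * (path_sum ev t x)%:R + 2 ^+ t :> R.
  by move: h3; rewrite -(ler_nat R) natrD !natrM !natrX.
have {}h4 : 2 ^+ n * (path_sum ev t x)%:R <= (b%:R + 1) * 2 ^+ t :> R.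
  by move: h4; rewrite -(ler_nat R) !natrM !natrX natr1.
split=> //.
- rewrite -[X in _ - X]mul1r -mulrBl /path_value ler_pdivrMr// mulrAC ler_pdivlMr//.
  by rewrite mulrBl mul1r lerBlDr [X in _ <= X + _]mulrC.
- rewrite -[X in _ + X]mul1r -mulrDl /path_value ler_pdivrMr// mulrAC ler_pdivlMr//.
  by rewrite [X in X <= _]mulrC.
Qed.

(** The size of the kick at stage t, if p makes x suspicious at that time. *)
Definition blame e x p t : R :=
  if suspicious_for ev e (kx e t) t (prefix_value x t) p then kick_size e t else 0.

Lemma kick_size_ge0 e t : 0 <= kick_size e t.
Proof. by rewrite /kick_size; case: ifP => // _; rewrite invr_ge0. Qed.

Lemma spent_mono e t t' : (t <= t')%N -> spent e t <= spent e t'.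
Proof.
move=> /subnK <-; elim: (t' - t)%N => [//|d IH]; apply: le_trans IH _.
by rewrite addSn spent_step lerDl kick_size_ge0.
Qed.

Definition hit e x p t := kick e t &&
  suspicious_for ev e (kx e t) t (prefix_value x t) p.

(** What is blamed on p is bounded by everything spent from the first hit t1 to
    the last hit t2, included. *)
Lemma blame_window e x p N : \sum_(0 <= t < N) blame e x p t = 0 \/
  exists t1 t2, [/\ (t1 <= t2 < N)%N, hit e x p t1, hit e x p t2 &
    \sum_(0 <= t < N) blame e x p t <= spent e t2.+1 - spent e t1].
Proof.
elim: N => [|N IH]; first by rewrite big_geq//; left.
rewrite big_nat_recr//=; set A := \sum_(0 <= _ < _) _ in IH *.
have [hN|hN] := boolP (hit e x p N); last first.
  have -> : blame e x p N = 0.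
    move: hN; rewrite /hit /blame /kick_size.
    by case: (kick e N) => /= [/negbTE ->|_]; last rewrite if_same.
  rewrite addr0; case: IH => [->|[t1 [t2 [/andP[t12 t2N] h1 h2 h]]]]; first by left.
  by right; exists t1, t2; split=> //; rewrite t12 ltnS ltnW.
have -> : blame e x p N = spent e N.+1 - spent e N.
  by rewrite spent_step addrAC subrr add0r /blame; case/andP: hN => _ ->.
right; case: IH => [->|[t1 [t2 [/andP[t12 t2N] h1 h2 h]]]].
  by exists N, N; rewrite add0r leqnn ltnSn.
exists t1, N; split=> //; first by rewrite (leq_trans t12) ?ltnSn// ltnW.
by have := spent_mono e t2N; lra.
Qed.

(** Between the first and the last hit f_t(x) stays in an interval of length
    2 * 2^-n, so that the kicks before the last hit sum to at most
    2^(2e) * 2 * 2^-n. The last one has size at most 2^-n. *)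
Lemma blame_sum e x p a T : ev T p = a.+1 ->
  \sum_(0 <= t < T) blame e x p t <= 3 * 2 ^+ (2 * e) / 2 ^+ size (string_of a).
Proof.
move=> pa; set n := size (string_of a).
case: (blame_window e x p T); first by move=> ->; rewrite divr_ge0// mulr_ge0.
move=> [t1 [t2 [/andP[t12 t2T] /andP[k1 s1] /andP[k2 s2] h]]].
have evT t : (t < T)%N -> suspicious_for ev e (kx e t) t (prefix_value x t) p ->
    ev t p = a.+1.
  move=> tT /andP[+ _]; case E: (ev t p) => [//|b] _.
  by move: (ev_mono (ltnW tT) E); rewrite pa.
have [_ n1 l1 u1] := suspicious_forP (evT _ (leq_ltn_trans t12 t2T) s1) s1.
have [_ n2 l2 u2] := suspicious_forP (evT _ t2T s2) s2.
apply: le_trans h _; rewrite spent_step.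
have := spent_le_path_value x k1 k2 t12; rewrite /kick_size k2.
have : 2 ^- kx e t2 <= 2 ^- n :> R.
  by rewrite lef_pV2 ?posrE// ler_eXn2l// ltr1n.
have : 2 ^+ (2 * e) * (path_value t2 x - path_value t1 x) <= 2 ^+ (2 * e) * (2 * 2 ^- n).
  by rewrite ler_pM2l// -/n in l1 u1 l2 u2 *; lra.
have : 2 ^- n <= 2 ^+ (2 * e) * 2 ^- n :> R.
  by rewrite ler_peMl ?invr_ge0// exprn_ege1// ler1n.
lra.
Qed.

Lemma blame_sum_le e x p T : \sum_(0 <= t < T) blame e x p t <=
  3 / 2 ^+ (2 * e + 4) * ((0 < ev T p)%:R * 2 ^- size (string_of p)).
Proof.
case: (blame_window e x p T) => [->|[t1 [t2 [/andP[t12 t2T] _ h _]]]].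
  by rewrite mulr_ge0 ?divr_ge0// mulr_ge0// invr_ge0.
case/andP: h => _ s2; have : (0 < ev t2 p)%N by case/andP: s2.
case E: (ev t2 p) => [//|a] _; have := ev_mono (ltnW t2T) E => ET.
have [n2 _ _ _] := suspicious_forP E s2.
rewrite ET mul1r; apply: le_trans (blame_sum e x ET) _.
have : 2 ^- size (string_of a) <= 2 ^- (size (string_of p) + (4 * e + 4)) :> R.
  by rewrite lef_pV2 ?posrE// ler_eXn2l// ltr1n.
set u := 2 ^- size (string_of a) => hu.
apply: (@le_trans _ _ (3 * 2 ^+ (2 * e) * 2 ^- (size (string_of p) + (4 * e + 4)))).
  by rewrite ler_pM2l// mulr_gt0.
rewrite le_eqVlt; apply/orP; left; apply/eqP.
rewrite (_ : 4 * e + 4 = (2 * e) + (2 * e + 4))%N; last by lia.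
by rewrite !exprD; field; rewrite !expr2_neq0.
Qed.

(** At each kick more than a fraction 2^-e of the j < 2^T is suspicious. Exchange
    the sums over t and j, and use the bounds on the blame of each program. *)
Lemma spent_lt1 e T : spent e T < 1.
Proof.
(* Averages over points of Cantor space are averages over their first T bits. *)
have path j : (j < 2 ^ T)%N -> exists x, forall t, (t <= T)%N ->
    prefix_value x t = (j %/ 2 ^ (T - t))%N.
  move=> /bin_value_surj[s sT sj]; exists (nth false s) => t tT.
  rewrite -(prefix_value_div _ tT); congr (_ %/ _)%N.
  by rewrite /prefix_value -sT mkseq_nth.
have step t : (t < T)%N -> kick_size e t <= 2 ^+ e / 2 ^+ T *
    \sum_(0 <= j < 2 ^ T) (if suspicious ev e (kx e t) t (j %/ 2 ^ (T - t)) then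
       kick_size e t else 0).
  move=> tT; rewrite /kick_size; case: ifP => [kt|_]; last first.
    by rewrite mulr_ge0 ?divr_ge0// sumr_ge0// => j _; case: ifP.
  rewrite (eq_bigr (fun j => 2 ^- kx e t *
    (suspicious ev e (kx e t) t (j %/ 2 ^ (T - t)))%:R)); last first.
    by move=> j _; case: ifP; rewrite ?mulr1 ?mulr0.
  (* Being suspicious at stage t depends on the first t bits only. *)
  rewrite -big_distrr/= -natr_sum.
  have -> : (\sum_(0 <= j < 2 ^ T) suspicious ev e (kx e t) t (j %/ 2 ^ (T - t)) =
      2 ^ (T - t) * suspicious_count ev e (kx e t) t)%N.
    rewrite -{1}(subnK (ltnW tT)) expnD.
    by rewrite (sum_div (fun i => nat_of_bool (suspicious ev e (kx e t) t i))) ?expn_gt0.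
  have : (2 ^ t)%:R <= (2 ^ e * suspicious_count ev e (kx e t) t)%:R :> R.
    by rewrite ler_nat ltnW//; case/andP: kt.
  rewrite !natrM !natrX => ht.
  rewrite mulrCA -[leLHS]mulr1 ler_pM2l ?invr_gt0//.
  rewrite mulrAC ler_pdivlMr// mul1r -{1}(subnKC (ltnW tT)) exprD.
  by rewrite mulrCA [leRHS]mulrC ler_pM2r.
have total : spent e T <= 2 ^+ e / 2 ^+ T * \sum_(0 <= j < 2 ^ T)
    (3 / 2 ^+ (2 * e + 4)).
  rewrite spentE.
  apply: (@le_trans _ _ (\sum_(0 <= t < T) 2 ^+ e / 2 ^+ T *
    \sum_(0 <= j < 2 ^ T) (if suspicious ev e (kx e t) t (j %/ 2 ^ (T - t)) then
       kick_size e t else 0))).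
    by rewrite big_nat_cond [leRHS]big_nat_cond ler_sum// => t /andP[/andP[_ /step]].
  rewrite -big_distrr/= ler_pM2l ?divr_gt0// exchange_big_nat/=.
  rewrite big_nat_cond [leRHS]big_nat_cond ler_sum// => j /andP[/andP[_ /path[{}x xE]] _].
  apply: (@le_trans _ _ (\sum_(0 <= t < T) \sum_(0 <= p < (2 ^ T.+1).-1) blame e x p t)).
    rewrite big_nat_cond [leRHS]big_nat_cond ler_sum// => t /andP[/andP[_ tT] _].
    have bl0 p : 0 <= blame e x p t.
      by rewrite /blame; case: ifP => // _; exact: kick_size_ge0.
    rewrite -xE ?(ltnW tT)//; case: ifP => [/hasP[p]|_]; last exact: sumr_ge0.
    rewrite mem_iota add0n => /andP[_ pt] hp.
    rewrite (big_rem p)/=; last first.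
      rewrite mem_index_iota ltn_num_strings (leq_trans _ (ltnW tT))//.
      by rewrite -ltn_num_strings.
    by rewrite {1}/blame hp lerDl sumr_ge0.
  rewrite exchange_big_nat/=.
  apply: (@le_trans _ _ (\sum_(0 <= p < (2 ^ T.+1).-1)
    3 / 2 ^+ (2 * e + 4) * ((0 < ev T p)%:R * 2 ^- size (string_of p)))).
    by rewrite ler_sum// => p _; exact: blame_sum_le.
  rewrite -big_distrr/= -[leRHS]mulr1 ler_pM2l ?divr_gt0//.
  rewrite -(ler_pM2l (expr2_gt0 T)) mulr1 -natrX.
  apply: le_trans (_ : _ <= (\sum_(0 <= p < (2 ^ T.+1).-1)
    (0 < ev T p) * 2 ^ (T - size (string_of p)))%:R) _; last first.
    by rewrite ler_nat kraft.
  rewrite natr_sum big_distrr/= big_nat_cond [leRHS]big_nat_cond ler_sum//.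
  move=> p /andP[/andP[_]]; rewrite ltn_num_strings => pT _.
  have -> : (2 ^ T)%:R = 2 ^+ (T - size (string_of p)) * 2 ^+ size (string_of p) :> R.
    by rewrite natrX -exprD subnK.
  rewrite natrM !natrX.
  by rewrite le_eqVlt; apply/orP; left; apply/eqP; field; rewrite expr2_neq0.
apply: le_lt_trans total _.
rewrite sumr_const_nat subn0 -[X in _ * X]mulr_natr natrX.
have -> : 2 ^+ e / 2 ^+ T * (3 / 2 ^+ (2 * e + 4) * 2 ^+ T) = 3 / 16 / 2 ^+ e :> R.
  by rewrite !exprD; field; rewrite !expr2_neq0.
rewrite ltr_pdivrMr// mul1r; apply: (@lt_le_trans _ _ 1); first lra.
by rewrite exprn_ege1// ler1n.
Qed.

End accounting.

(** * Quiet stages *)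

Section quiet.
Variable ev : nat -> nat -> nat.
Hypothesis ev_mono : forall t t' p y, t <= t' -> ev t p = y.+1 -> ev t' p = y.+1.
Hypothesis ev_prefix_free : forall t p p', 0 < ev t p -> 0 < ev t p' ->
  prefix (string_of p) (string_of p') -> p = p'.
Variable c : nat.
Hypothesis ev_simulates : forall s u, kick_machine ev s = Some u ->
  exists t p, ev t p = (string_code u).+1 /\ size (string_of p) <= size s + c.

Lemma st_used_lt e t : st_used ev e t < 2 ^ st_exp ev e t.
Proof.
have := spent_lt1 rat ev_mono ev_prefix_free e t.
by rewrite /spent ltr_pdivrMr ?expr2_gt0// mul1r -natrX ltr_nat.
Qed.

Lemma pending_kick e t : st_pend ev e t = 0 \/ exists u,
  [/\ is_kick ev e u, st_pend ev e t = u.+1 & st_exp ev e u <= st_exp ev e t].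
Proof.
elim: t => [|t IH]; first by left.
have [[kt kE _ pE]|[_ _ kE _ ->]|[_ _ kE _ ->]] := state_step ev e t.
- by right; exists t; rewrite kE.
- by case: IH => [|[u [hu pu ku]]]; [left|right; exists u; rewrite kE ltnW].
- by case: IH => [|[u [hu pu ku]]]; [left|right; exists u; rewrite kE].
Qed.

(** The kick is described by e + 1 + k bits for the kick machine, hence by
    e + 1 + k + c bits for U, and this is at most k + 2e. *)
Lemma eventually_confirmed e t : c < e -> exists2 t', t <= t' &
  confirmed ev e t' (st_exp ev e t') (st_pend ev e t').
Proof.
move=> ce; apply: contrapT => none.
have unconf t' : t <= t' -> ~~ confirmed ev e t' (st_exp ev e t') (st_pend ev e t').
  by move=> tt'; apply/negP => h; apply: none; exists t'.
have const d : st_exp ev e (d + t) = st_exp ev e t /\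
    st_pend ev e (d + t) = st_pend ev e t.
  elim: d => [//|d [IH1 IH2]]; have nc := unconf _ (leq_addl d t).
  rewrite addSn; have [[kt _ _ _]|[_ h _ _ _]|[_ _ -> _ ->//]] := state_step ev e (d + t).
    by move: nc; rewrite (andP kt).1.
  by rewrite h in nc.
case: (pending_kick e t) => [p0|[u [ku pu kuE]]].
  by move: (unconf _ (leqnn t)); rewrite /confirmed p0 eqxx.
have [s /ev_simulates[t1 [p [pE ps]]] sE] := kick_machine_program ku (st_used_lt e u).
(* At this stage the program p of U has halted, and p and its output are short
   enough to be taken into account. *)
pose t' := maxn (maxn t1 u.+1) (size (string_of p)) + t.
have tt' : t <= t' by exact: leq_addl.
move: (unconf _ tt'); rewrite /t'; have [-> ->] := const (maxn (maxn t1 u.+1) (size (string_of p))).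
rewrite -/t' /confirmed pu /= => /negP; apply.
have pt' : size (string_of p) <= t' by rewrite /t'; lia.
apply: (@leq_trans (2 ^ (t' - size (string_of p)) * 2 ^ (st_exp ev e t + 2 * e))).
  by rewrite -expnD leq_exp2l//; lia.
rewrite leq_mul2r weight_ge ?orbT//.
  by rewrite -string_code_nseq; apply: ev_mono pE; rewrite /t'; lia.
by rewrite -string_code_nseq string_codeK size_nseq /t'; lia.
Qed.

Lemma suspicious_mono e k k' t j : k <= k' ->
  suspicious ev e k t j -> suspicious ev e k' t j.
Proof.
move=> kk' /hasP[p pt /and5P[h1 h2 h3 h4 h5]]; apply/hasP; exists p => //.
by apply/and5P; split=> //; exact: leq_trans kk'.
Qed.

(** Otherwise, from stage N on, k is no longer incremented once it has reached N,
    so that it is bounded by some K. As w + k increases at every stage that finds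
    the last kick confirmed, the number w is then unbounded, in contradiction with w < 2^k <= 2^K. *)
Lemma quiet_stage e N : c < e -> exists2 t, N <= t &
  2 ^ e * suspicious_count ev e N t <= 2 ^ t.
Proof.
move=> ce; apply: contrapT => none.
have alarmed t : N <= t -> N <= st_exp ev e t -> alarm ev e t (st_exp ev e t).
  move=> Nt Nk; rewrite /alarm; apply: (@leq_trans (2 ^ e * suspicious_count ev e N t)).
    by rewrite ltnNge; apply/negP => h; apply: none; exists t.
  rewrite leq_mul2l leq_sum ?orbT// => j _.
  by case: (boolP (suspicious ev e N t j)) => // /(suspicious_mono Nk) ->.
pose K := maxn (st_exp ev e N) N.
have kK t : N <= t -> st_exp ev e t <= K.
  move=> /subnK <-; elim: (t - N) => [|d IH]; first by rewrite leq_maxl.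
  rewrite addSn.
  have [[_ -> _ _]//|[nk h -> _ _]|[_ _ -> _ _]//] := state_step ev e (d + N).
  rewrite ltnNge; apply/negP => Kk; move: nk; rewrite /is_kick h /= => /negP; apply.
  by apply: alarmed; [exact: leq_addl|exact: leq_trans (leq_maxr _ _) Kk].
have grow b : exists2 t, N <= t & b <= st_used ev e t + st_exp ev e t.
  elim: b => [|b [t Nt bt]]; first by exists N.
  have [t' tt' h] := eventually_confirmed t ce.
  exists t'.+1; first by rewrite (leq_trans Nt)// leqW.
  have [k1 u1] := state_mono ev e tt'.
  have u2 : st_used ev e t <= st_used ev e t'.
    by apply: leq_trans u1; rewrite -[X in X <= _]muln1 leq_mul ?expn_gt0 ?leq_addr.
  have [[_ -> -> _]|[_ _ -> -> _]|[_ /negP//]] := state_step ev e t'; lia.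
have [t Nt] := grow (2 ^ K + K).+1.
apply/negP; rewrite -ltnNge ltnS leq_add ?kK//.
by rewrite ltnW// (leq_trans (st_used_lt e t))// leq_exp2l ?kK.
Qed.

End quiet.

Import numFieldNormedType.Exports.
Local Open Scope classical_set_scope.
Local Open Scope ring_scope.

(** * The limit of the stages *)

Lemma bin_value_ltP s u : size s = size u ->
  (bin_value s < bin_value u)%N <-> exists n, [/\ (n < size s)%N,
    take n s = take n u, nth false s n = false & nth false u n = true].
Proof.
elim: s u => [|b s IH] [|c u] //=.
  by split=> [|[n []//]]; rewrite [bin_value [::]]big_geq.
move=> [su]; rewrite !bin_value_cons su.
have := bin_value_lt s; have := bin_value_lt u; rewrite su => hu hs.
have IH' := IH u su; rewrite su in IH'.
case: b c => [] [] /=; rewrite ?mul1n ?mul0n.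
- rewrite ltn_add2l IH'; split=> [[n [n1 n2 n3 n4]]|[[|n] [n1 n2 n3 n4]]] //.
    by exists n.+1; rewrite /= n2.
  by exists n; case: n2.
- by split=> [|[[|n] []//]]; lia.
- by split=> [_|_]; [exists 0%N|lia].
- rewrite !add0n IH'; split=> [[n [n1 n2 n3 n4]]|[[|n] [n1 n2 n3 n4]]] //.
    by exists n.+1; rewrite /= n2.
  by exists n; case: n2.
Qed.

Lemma take_mkseq T (f : nat -> T) n m : (n <= m)%N -> take n (mkseq f m) = mkseq f n.
Proof. by move=> nm; rewrite /mkseq -map_take take_iota (minn_idPl nm). Qed.

Lemma le_LE s (x : cantor) : le_L s x <-> (bin_value s <= prefix_value x (size s))%N.
Proof.
have := @bin_value_ltP s (mkseq x (size s)); rewrite size_mkseq => /(_ erefl) lt.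
have ltE : lt_L s x <-> (bin_value s < prefix_value x (size s))%N.
  rewrite lt; split=> -[n [n1 n2 n3 n4]]; exists n; split=> //.
  - by rewrite take_mkseq// ltnW.
  - by rewrite nth_mkseq.
  - by rewrite n2 take_mkseq// ltnW.
  - by rewrite nth_mkseq in n4.
rewrite /le_L ltE [X in _ <-> is_true X]leq_eqVlt; split.
  by case=> [->|{1}->]; rewrite ?orbT// /prefix_value eqxx.
case/predU1P => [e|]; [right|by left].
by apply: bin_value_inj e; rewrite size_mkseq.
Qed.

Section limit.
Variable R : realType.
Variable U : seq bool -> option (seq bool).

Lemma complexity_le p s : U p = Some s -> (complexity R U s <= (size p)%:R%:E)%E.
Proof. by move=> ps; apply: ereal_inf_lbound; exists p. Qed.

Lemma complexity_attained s :
  (complexity R U s = +oo%E /\ forall p, U p <> Some s) \/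
  exists2 p, U p = Some s & complexity R U s = (size p)%:R%:E.
Proof.
have [[p0 hp0]|none] := pselect (exists p, U p = Some s); last first.
  left; split=> [|p ps]; last by apply: none; exists p.
  rewrite /complexity (_ : image _ _ = set0) ?ereal_inf0//.
  by rewrite -subset0 => y [p /= ps _]; case: none; exists p.
have ex : exists n, `[< exists2 p, U p = Some s & size p = n >].
  by exists (size p0); apply/asboolP; exists p0.
right; have [n /asboolP[p ps <-] pmin] := ex_minnP ex; exists p => //.
apply/eqP; rewrite eq_le complexity_le//=.
apply: le_ereal_inf_tmp => _ [q /= qs <-]; rewrite lee_fin ler_nat.
by apply: pmin; apply/asboolP; exists q.
Qed.

Definition mass s : R := exp2N (complexity R U s).

Lemma massP s : mass s = 0 \/ exists2 p, U p = Some s & mass s = 2 ^- size p.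
Proof.
rewrite /mass; case: (complexity_attained s) => [[-> _]|[p ps ->]]; first by left.
by right; exists p => //=; rewrite powRN powR_mulrn.
Qed.

Lemma mass_ge p s : U p = Some s -> 2 ^- size p <= mass s.
Proof.
rewrite /mass => ps; have := complexity_le ps.
case: (complexity_attained s) => [[_ /(_ p)//]|[q qs ->]].
rewrite lee_fin ler_nat => qp /=; rewrite powRN powR_mulrn// lef_pV2 ?posrE ?exprn_gt0//.
by rewrite ler_eXn2l// ltr1n.
Qed.

Lemma mass_ge0 s : 0 <= mass s.
Proof.
by case: (massP s) => [->//|[p _ ->]]; rewrite invr_ge0 exprn_ge0.
Qed.

Variable ev : nat -> nat -> nat.
Hypothesis ev_mono : forall t t' p y,
  (t <= t')%N -> ev t p = y.+1 -> ev t' p = y.+1.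
Hypothesis ev_prefix_free : forall t p p', (0 < ev t p)%N -> (0 < ev t p')%N ->
  prefix (string_of p) (string_of p') -> p = p'.
Hypothesis ev_spec : forall s u, U s = Some u <->
  exists t, ev t (string_code s) = (string_code u).+1.

Lemma weight_le_mass t a : (weight ev t a)%:R / 2 ^+ t <= mass (string_of a).
Proof.
case: (weight_attained ev t a) => [->|[p [pa pt at_ ->]]].
  by rewrite mul0r mass_ge0.
have : U (string_of p) = Some (string_of a).
  by apply/ev_spec; exists t; rewrite !string_ofK.
move=> /mass_ge; apply: le_trans.
rewrite natrX ler_pdivrMr ?exprn_gt0// -{2}(subnK pt) exprD mulrC.
by rewrite mulfK ?expr2_neq0.
Qed.

(** A string has its final complexity from some stage on. *)
Lemma mass_le_weight s : exists T, forall t, (T <= t)%N ->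
  mass s <= (weight ev t (string_code s))%:R / 2 ^+ t.
Proof.
case: (massP s) => [->|[p /ev_spec[t0 ht0] ->]].
  by exists 0%N => t _; rewrite divr_ge0.
exists (maxn t0 (maxn (size s) (size p))) => t; rewrite !geq_max => /and3P[h1 h2 h3].
have := @weight_ge ev t _ _ (ev_mono h1 ht0); rewrite !string_codeK => /(_ h3 h2).
rewrite -(ler_nat R) natrX => h; rewrite ler_pdivlMr ?exprn_gt0//.
apply: le_trans h; rewrite -{1}(subnK h3) exprD mulrC.
by rewrite mulfK ?expr2_neq0.
Qed.

Lemma path_valueE t x : path_value R ev t x = \sum_(0 <= a < (2 ^ t.+1).-1 |
    (bin_value (string_of a) <= prefix_value x (size (string_of a)))%N)
  (weight ev t a)%:R / 2 ^+ t.
Proof.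
rewrite /path_value (path_sumE ev x (leqnn t)) natr_sum big_distrl [RHS]big_mkcond/=.
apply: eq_bigr => a _; rewrite natrM.
by case: ifP; rewrite ?mul1r ?mul0r.
Qed.

Lemma path_value_le1 t x : path_value R ev t x <= 1.
Proof.
rewrite /path_value ler_pdivrMr ?exprn_gt0// mul1r -natrX ler_nat.
exact: stage_sum_le.
Qed.

Definition left_esum (x : cantor) : \bar R :=
  (\esum_(s in [set s | le_L s x]) (mass s)%:E)%E.

Lemma path_value_le_esum t (x : cantor) : ((path_value R ev t x)%:E <= left_esum x)%E.
Proof.
pose r := [seq string_of a | a <- index_iota 0 (2 ^ t.+1).-1 &
  (bin_value (string_of a) <= prefix_value x (size (string_of a)))%N].
have ur : uniq r.
  by rewrite map_inj_uniq ?filter_uniq ?iota_uniq//; exact: can_inj string_ofK.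
apply: esum_ge; exists [set` r].
  split; first exact: finite_seq.
  by move=> s /= /mapP[a]; rewrite mem_filter => /andP[ha _] ->; apply/le_LE.
rewrite -fsbig_seq// sumEFin lee_fin path_valueE big_map big_filter.
by apply: ler_sum => a _; exact: weight_le_mass.
Qed.

(** A finite set of strings has its full mass at some stage. With [path_value_le1] this
    also yields that the sum defining f(x) is finite. *)
Lemma left_esum_le (x : cantor) z : (forall t, ((path_value R ev t x)%:E <= z)%E) ->
  (left_esum x <= z)%E.
Proof.
move=> hz; apply: ge_ereal_sup => _ [X [Xfin Xx] <-].
rewrite fsbig_finite// sumEFin; set r : seq (seq bool) := finmap.enum_fset (fset_set X).
have [T hT] := choice mass_le_weight.
(* Only strings of length at most t count at stage t. *)
pose t := maxn (\max_(s <- r) T s) (\max_(s <- r) size s).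
apply: le_trans (hz t); rewrite lee_fin path_valueE.
have ur : uniq [seq string_code s | s <- r].
  rewrite map_inj_uniq; first exact: finmap.fset_uniq.
  exact: can_inj string_codeK.
have rX s : s \in r -> X s by rewrite in_fset_set// inE.
apply: (@le_trans _ _ (\sum_(a <- [seq string_code s | s <- r])
   (weight ev t a)%:R / 2 ^+ t)).
  rewrite big_map big_seq [leRHS]big_seq; apply: ler_sum => s sr.
  by apply: hT; rewrite leq_max leq_bigmax_seq.
rewrite -[leRHS]big_filter; set l := [seq a <- _ | _].
have lr : {subset [seq string_code s | s <- r] <= l}.
  move=> _ /mapP[s sr ->]; rewrite mem_filter /= string_codeK mem_index_iota.
  rewrite ltn_string_code /t leq_max [X in _ || X]leq_bigmax_seq// orbT andbT.
  by rewrite ?andbT; apply/le_LE; apply: Xx; exact: rX.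
have ul : uniq l by rewrite filter_uniq// iota_uniq.
rewrite [leRHS](bigID (mem [seq string_code s | s <- r]))/=.
rewrite -[X in _ <= X + _]big_filter.
have perm : perm_eq [seq a <- l | a \in [seq string_code s | s <- r]]
    [seq string_code s | s <- r].
  apply: uniq_perm => //; first by rewrite filter_uniq.
  by move=> a; rewrite mem_filter /=; apply/andb_idr => /lr.
by rewrite (perm_big _ perm)/= lerDl sumr_ge0// => a _; exact: divr_ge0.
Qed.

Lemma left_sum_EFin (x : cantor) : (left_sum R U x)%:E = left_esum x.
Proof.
rewrite /left_sum -/(left_esum x) fineK// ge0_fin_numE.
  apply: (@le_lt_trans _ _ 1%:E); last exact: ltry.
  by apply: left_esum_le => t; rewrite lee_fin path_value_le1.
by apply: esum_ge0 => s _; rewrite lee_fin mass_ge0.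
Qed.

Lemma path_value_le_left_sum t (x : cantor) : path_value R ev t x <= left_sum R U x.
Proof. by rewrite -lee_fin left_sum_EFin path_value_le_esum. Qed.

Lemma path_value_gt (x : cantor) y : y < left_sum R U x -> exists t, y < path_value R ev t x.
Proof.
move=> yl; apply: contrapT => h; move: yl; apply/negP; rewrite -leNgt.
rewrite -lee_fin left_sum_EFin; apply: left_esum_le => t; rewrite lee_fin leNgt.
by apply/negP => yt; apply: h; exists t.
Qed.

Lemma left_sum_ge0 (x : cantor) : 0 <= left_sum R U x.
Proof. by apply: le_trans (path_value_le_left_sum 0 x); rewrite divr_ge0. Qed.

Lemma left_sum_le1 (x : cantor) : left_sum R U x <= 1.
Proof.
by rewrite -lee_fin left_sum_EFin; apply: left_esum_le => t; rewrite lee_fin path_value_le1.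
Qed.

End limit.

(** * Measure of the suspicious points *)

Lemma prefix_valueS x n : prefix_value x n.+1 = ((prefix_value x n).*2 + x n)%N.
Proof. by rewrite /prefix_value mkseqS bin_value_rcons. Qed.

Section expansion.
Variable R : realType.

(** The digits are produced by doubling the remainder and subtracting the digit;
    the remainder stays in [0, 1], also for y = 1. *)
Lemma binary_expansionP (y : R) : 0 <= y <= 1 -> exists z : cantor,
  binary_expansion y z /\ forall n,
    (prefix_value z n)%:R / 2 ^+ n <= y <= (prefix_value z n)%:R / 2 ^+ n + 2 ^- n.
Proof.
move=> y01; pose r n : R := iter n (fun r : R => 2 * r - (2^-1 <= r)%R%:R) y.
pose z : cantor := fun n => (2^-1 <= r n :> R).
have r01 n : 0 <= r n <= 1.
  elim: n => [//|n IH]; rewrite /r iterS -/(r n).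
  by move: IH; case: (leP 2^-1 (r n)) => /=; lra.
have yE n : y = (prefix_value z n)%:R / 2 ^+ n + r n / 2 ^+ n.
  elim: n => [|n IH]; first by rewrite /prefix_value [bin_value _]big_geq// expr0 mul0r add0r divr1.
  rewrite {1}IH prefix_valueS /r iterS -/(r n) natrD -muln2 natrM exprS invfM.
  by rewrite /z; field; rewrite expr2_neq0.
have sandwich n :
    (prefix_value z n)%:R / 2 ^+ n <= y <= (prefix_value z n)%:R / 2 ^+ n + 2 ^- n.
  have i0 : 0 < 2 ^- n :> R by rewrite invr_gt0 exprn_gt0.
  have /andP[r0 r1] := r01 n; rewrite (yE n) lerDl lerD2l.
  by rewrite divr_ge0 ?exprn_ge0//= ler_piMl// ltW.
exists z; split=> //; rewrite /binary_expansion.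
have sE n : series (fun k => (z k)%:R / 2 ^+ k.+1 : R) n = (prefix_value z n)%:R / 2 ^+ n.
  elim: n => [|n IH].
    by rewrite seriesEnat /= big_geq// /prefix_value [bin_value _]big_geq// mul0r.
  move: IH; rewrite !seriesEnat /= big_nat_recr//= => ->.
  rewrite prefix_valueS natrD -muln2 natrM exprS invfM.
  by field; rewrite expr2_neq0.
apply: (@squeeze_cvgr _ _ _ _ (fun n => y - 2^-1 ^+ n) (cst y)).
- apply: nearW => n; have := sandwich n; rewrite -sE /= exprVn.
  by move=> /andP[h1 h2]; rewrite h1 andbT lerBlDr.
- rewrite -[X in _ --> X]subr0; apply: cvgB; first exact: cvg_cst.
  by apply: cvg_expr; rewrite ger0_norm ?invr_ge0//; lra.
- exact: cvg_cst.
Qed.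

End expansion.

Section measure.
Variable R : realType.

Lemma measurable_cylinder s : measurable (cylinder s : set cantor).
Proof. by apply: sub_sigma_algebra; exists s. Qed.

Lemma measurable_prefix t (P : pred nat) :
  measurable ([set x | P (prefix_value x t)] : set cantor).
Proof.
rewrite (_ : [set x | _] = \bigcup_(a in [set a | size (string_of a) = t /\
    P (bin_value (string_of a))]) cylinder (string_of a)).
  by apply: bigcup_measurable => a _; exact: measurable_cylinder.
apply/seteqP; split=> [x /= Px|x [a /= [at_ Pa]]].
  by exists (string_code (mkseq x t)); rewrite /cylinder/= !string_codeK size_mkseq.
by rewrite /cylinder /= at_ /prefix_value => ->.
Qed.

Lemma uniform_measure_prefix t (P : pred nat) :
  (uniform_measure R [set x | P (prefix_value x t)] <=
    ((\sum_(0 <= j < 2 ^ t) P j)%:R / 2 ^+ t)%:E)%E.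
Proof.
have ex j : exists s, (j < 2 ^ t)%N -> size s = t /\ bin_value s = j.
  have [jt|jt] := ltnP j (2 ^ t); last by exists [::].
  by have [s s1 s2] := bin_value_surj jt; exists s.
have [s hs] := choice ex.
pose A j : set cantor := if P j then cylinder (s j) else set0.
have mA j : measurable (A j).
  by rewrite /A; case: ifP => _; [exact: measurable_cylinder|exact: measurable0].
apply: (@le_trans _ _ (uniform_measure R (\big[setU/set0]_(j < 2 ^ t) A j))).
  apply: le_measure; rewrite ?inE; first exact: measurable_prefix.
    by apply: bigsetU_measurable.
  move=> x /= Px; rewrite -bigcup_mkord; exists (prefix_value x t) => /=.
    by have := bin_value_lt (mkseq x t); rewrite size_mkseq.
  rewrite /A Px /cylinder/=.
  have [|s1 s2] := hs (prefix_value x t).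
    by have := bin_value_lt (mkseq x t); rewrite size_mkseq.
  by apply: bin_value_inj; rewrite ?size_mkseq// s1 s2.
apply: le_trans (Boole_inequality _ _) _; first by move=> i _; exact: mA.
rewrite big_mkord natr_sum big_distrl/= -sumEFin; apply: lee_sum => j _.
rewrite /A; case: ifP => _; last by rewrite measure0 mul0r.
rewrite le_eqVlt; apply/orP; left; apply/eqP/(etrans (uniform_measure_cylinder R (s j))).
by rewrite (hs j _).1// mul1r.
Qed.

End measure.

Section final.
Variable R : realType.
Variable U : seq bool -> option (seq bool).

Lemma machine_stages : prefix_free_machine U -> exists ev : nat -> nat -> nat,
  [/\ computable 2 (fun u => ev (head 0%N u) (head 0%N (behead u))),
    forall t t' p y, (t <= t')%N -> ev t p = y.+1 -> ev t' p = y.+1,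
    forall t p p', (0 < ev t p)%N -> (0 < ev t p')%N ->
      prefix (string_of p) (string_of p') -> p = p' &
    forall s u, U s = Some u <->
      exists t, ev t (string_code s) = (string_code u).+1].
Proof.
move=> [[c cP] pf]; have [E [Ec Em Es]] := fuel_evaluator c.
have spec s u : U s = Some u <->
    exists t, E t [:: string_code s] = (string_code u).+1.
  by rewrite cP Es.
exists (fun t p => E t [:: p]); split=> //.
- apply: eq_computable Ec => v.
  by case/tupleP: v => a v; case/tupleP: v => b v; rewrite [v]tuple0.
- by move=> t t' p y; exact: Em.
move=> t p p'.
have halt q : (0 < E t [:: q])%N -> U (string_of q) <> None.
  case e: (E t [:: q]) => [//|y] _.
  suff -> : U (string_of q) = Some (string_of y) by [].
  by apply/spec; exists t; rewrite !string_ofK.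
move=> /halt h /halt h' /(pf _ _ h h') e.
by rewrite -(string_ofK p) e string_ofK.
Qed.

Lemma complexity_le_program s n : (complexity R U s <= n%:R%:E)%E ->
  exists2 p, U p = Some s & (size p <= n)%N.
Proof.
case: (complexity_attained R U s) => [[-> _]|[p ps ->]]; first by rewrite leye_eq.
by rewrite lee_fin ler_nat => pn; exists p.
Qed.

Variable ev : nat -> nat -> nat.
Hypothesis ev_mono : forall t t' p y,
  (t <= t')%N -> ev t p = y.+1 -> ev t' p = y.+1.
Hypothesis ev_prefix_free : forall t p p', (0 < ev t p)%N -> (0 < ev t p')%N ->
  prefix (string_of p) (string_of p') -> p = p'.
Hypothesis ev_spec : forall s u, U s = Some u <->
  exists t, ev t (string_code s) = (string_code u).+1.

(** The number N bounds both the stage from which on x is suspicious and the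
    length of the strings involved, so that these sets increase with N. *)
Definition eventually_suspicious e N : set cantor :=
  [set x | forall t, (N <= t)%N -> suspicious ev e N t (prefix_value x t)].

(** The program of a compressible prefix w of an expansion of f(x) makes x
    suspicious from the stage at which f_t(x) exceeds 0.w - 2^-n. *)
Lemma nonrandom_eventually_suspicious (x : cantor) e : ~ real_one_random U (left_sum R U x) ->
  exists N, eventually_suspicious e N x.
Proof.
set y := left_sum R U x => nr.
have y01 : 0 <= y <= 1.
  by rewrite (left_sum_ge0 R ev_mono ev_prefix_free ev_spec) (left_sum_le1 R ev_mono ev_prefix_free ev_spec).
have [z [zy zn]] := binary_expansionP y01.
have [n nz] : exists n, ~ ((n%:R - (4 * e + 4)%N%:R)%:E <= complexity R U (mkseq z n))%E.
  apply: contrapT => h; apply: nr; exists z; split=> //; exists (4 * e + 4)%N => n.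
  by apply: contrapT => hn; apply: h; exists n.
have [p pz pn] : exists2 p, U p = Some (mkseq z n) & (size p + (4 * e + 4) <= n)%N.
  case: (complexity_attained R U (mkseq z n)) => [[e1 _]|[p pz e1]]; rewrite e1 in nz.
    by rewrite leey in nz.
  exists p => //; move/negP: nz; rewrite lee_fin -ltNge ltrBrDr -natrD ltr_nat.
  exact: ltnW.
have /ev_spec[t0 ht0] := pz.
have /andP[ylow yup] := zn n.
have i0 : 0 < 2 ^- n :> R by rewrite invr_gt0 exprn_gt0.
have [t1 ht1] : exists t1, (prefix_value z n)%:R / 2 ^+ n - 2 ^- n < path_value R ev t1 x.
  by apply: (path_value_gt ev_mono ev_prefix_free ev_spec); rewrite -/y; lra.
exists (maxn (maxn t0 t1) (maxn n (size p))) => t; rewrite !geq_max.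
set N := maxn _ _ => /andP[/andP[h0 h1] /andP[h2 h3]].
apply/hasP; exists (string_code p).
  by rewrite mem_iota leq0n add0n ltn_string_code.
have evp := ev_mono h0 ht0.
rewrite /suspicious_for evp /= !string_codeK size_mkseq pn -/(path_sum ev t x).
have -> /= : (n <= N)%N by rewrite /N !leq_max leqnn !orbT.
have lo : (prefix_value z n)%:R / 2 ^+ n - 2 ^- n <= path_value R ev t x.
  exact: le_trans (ltW ht1) (path_value_mono R ev_mono x h1).
have up : path_value R ev t x <= (prefix_value z n)%:R / 2 ^+ n + 2 ^- n.
  exact: le_trans (path_value_le_left_sum R ev_mono ev_prefix_free ev_spec t x) yup.
have n0 : 0 < 2 ^+ n :> R by exact: expr2_gt0.
have t0' : 0 < 2 ^+ t :> R by exact: expr2_gt0.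
move: lo; rewrite -[X in _ - X]mul1r -mulrBl.
rewrite /path_value ler_pdivrMr// mulrAC ler_pdivlMr// => lo.
move: up; rewrite -[X in _ + X]mul1r -mulrDl.
rewrite /path_value ler_pdivrMr// mulrAC ler_pdivlMr// => up.
rewrite -!/(prefix_value z n); apply/andP; split; rewrite -(ler_nat R).
- by rewrite natrD !natrM !natrX; move: lo; rewrite mulrBl mul1r mulrC; lra.
- by rewrite !natrM !natrX -natr1; move: up; lra.
Qed.

Lemma measurable_eventually_suspicious e N : measurable (eventually_suspicious e N).
Proof.
rewrite (_ : eventually_suspicious e N = \bigcap_(t in [set t | (N <= t)%N])
  [set x | suspicious ev e N t (prefix_value x t)]).
  by apply: bigcap_measurableType => t _; exact: measurable_prefix.
by apply/seteqP; split=> x h t; exact: h.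
Qed.

Lemma eventually_suspicious_mono e N N' : (N <= N')%N -> eventually_suspicious e N `<=` eventually_suspicious e N'.
Proof.
move=> NN' x h t N't; apply: (suspicious_mono NN').
by apply: h; exact: leq_trans NN' N't.
Qed.

Variable c : nat.
Hypothesis ev_simulates : forall s u, kick_machine ev s = Some u ->
  exists t p, ev t p = (string_code u).+1 /\ (size (string_of p) <= size s + c)%N.

(** Such points are suspicious at a quiet stage. *)
Lemma uniform_measure_eventually_suspicious e N : (c < e)%N ->
  (uniform_measure R (eventually_suspicious e N) <= (2 ^- e)%:E)%E.
Proof.
move=> ce; have [t Nt ht] := quiet_stage ev_mono ev_prefix_free ev_simulates N ce.
apply: (@le_trans _ _ (uniform_measure R
    [set x | suspicious ev e N t (prefix_value x t)])).
  apply: le_measure; rewrite ?inE; first exact: measurable_eventually_suspicious.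
    exact: measurable_prefix.
  by move=> x h; exact: h.
apply: le_trans (uniform_measure_prefix R t _) _.
rewrite lee_fin ler_pdivrMr ?expr2_gt0// mulrC ler_pdivlMr ?expr2_gt0//.
by rewrite mulrC -!natrX -natrM ler_nat.
Qed.

Lemma uniform_measure_bigcup_eventually_suspicious e : (c < e)%N ->
  (uniform_measure R (\bigcup_N eventually_suspicious e N) <= (2 ^- e)%:E)%E.
Proof.
move=> ce; apply: (cvge_le (f := uniform_measure R \o eventually_suspicious e) (F := \oo)).
  by apply: nearW => N; exact: uniform_measure_eventually_suspicious.
apply: nondecreasing_cvg_mu.
- by move=> N; exact: measurable_eventually_suspicious.
- by apply: bigcupT_measurable => N; exact: measurable_eventually_suspicious.
- by move=> N N' NN'; apply/subsetPset; exact: eventually_suspicious_mono.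
Qed.

Lemma nonrandom_negligible : (uniform_measure R).-negligible
  [set x : cantor | ~ real_one_random U (left_sum R U x)].
Proof.
exists (\bigcap_(e in [set e | (c < e)%N]) \bigcup_N eventually_suspicious e N).
have mH e : measurable (\bigcup_N eventually_suspicious e N).
  by apply: bigcupT_measurable => N; exact: measurable_eventually_suspicious.
have mI : measurable (\bigcap_(e in [set e | (c < e)%N]) \bigcup_N eventually_suspicious e N).
  exact: bigcap_measurableType.
split=> //; last first.
  by move=> x /= nr e _; have [N hN] := nonrandom_eventually_suspicious e nr; exists N.
apply/eqP; rewrite eq_le measure_ge0 andbT; apply/lee_addgt0Pr => r r0.
(* With this choice of e we have 2^-e <= r. *)
rewrite add0e; pose n := (Num.truncn r^-1).+1; pose e := (c + n).+1.
apply: (@le_trans _ _ (2 ^- e)%:E); last first.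
  rewrite lee_fin -[leRHS]invrK lef_pV2 ?posrE ?expr2_gt0 ?invr_gt0//.
  apply: (@le_trans _ _ n%:R); first by rewrite ltW// truncnS_gt.
  rewrite -natrX ler_nat ltnW// (leq_trans (ltn_expl n (isT : 1 < 2)%N))//.
  by rewrite leq_exp2l// /e; lia.
apply: le_trans (uniform_measure_bigcup_eventually_suspicious (_ : c < e)%N); last first.
  by rewrite /e ltnS leq_addr.
apply: le_measure; rewrite ?inE//.
by move=> x h; apply: h; rewrite /= /e ltnS leq_addr.
Qed.

End final.

Theorem corollary5p3 (R : realType) (U : seq bool -> option (seq bool))
    (hU : optimal R U) :
  (uniform_measure R).-negligible
    [set x : cantor | ~ real_one_random U (left_sum R U x)].
Proof.
have [pfU opt] := hU; have [ev [evC evM evP evS]] := machine_stages pfU.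
have [c hc] := opt _ (kick_machine_prefix_free evC).
apply: (@nonrandom_negligible R U ev evM evP evS c) => s u su.
have [|p /evS[t ht] ps] := @complexity_le_program R U u (size s + c).
  rewrite natrD EFinD; apply: le_trans (hc u) _; rewrite leeD2r//.
  exact: complexity_le su.
by exists t, (string_code p); rewrite string_codeK.
Qed.
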